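(* Let $\omega=(\omega_x)_{x\in\mathbb{Z}}$ be a random environment, i.e. a sequence of i.i.d. random variables with values in $(0,1)$ under a probability measure $\mathsf{P}$, such that, with $\rho_0:=\frac{1-\omega_0}{\omega_0}$: (i) $\mathsf{E}[\log\rho_0]=0$; (ii) $\mathsf{P}(\varepsilon\le\omega_0\le 1-\varepsilon)=1$ for some $\varepsilon\in(0,\tfrac12)$; (iii) $\mathsf{Var}(\log\rho_0)>0$. Let $(X_n)_{n\in\mathbb{N}_0}$ be the random walk in the environment $\omega$ started at $0$, with quenched law $P_\omega$. Then for every $0\le\alpha<1$, $$\sum_{n\in\mathbb{N}}P_\omega(X_{2n}=0)\cdot n^{-\alpha}=\infty$$ for $\mathsf{P}$-a.e. environment $\omega$.
   Context: $\mathbb{N}=\{1,2,\dots\}$, $\mathbb{N}_0=\mathbb{N}\cup\{0\}$. For a fixed environment $\omega=(\omega_x)_{x\in\mathbb{Z}}\in(0,1)^{\mathbb{Z}}$ and $x\in\mathbb{Z}$, under $P_\omega^x$ the process $(X_n)_{n\in\mathbb{N}_0}$ is the Markov chain on $\mathbb{Z}$ with $P_\omega^x(X_0=x)=1$ and $P_\omega^x(X_{n+1}=y+1\mid X_n=y)=\omega_y=1-P_\omega^x(X_{n+1}=y-1\mid X_n=y)$ for all $y\in\mathbb{Z}$. $P_\omega:=P_\omega^0$. *)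

(* Defs.v *)
From HB Require Import structures.
From mathcomp Require Import all_boot all_order all_algebra.
From mathcomp Require Import all_classical all_reals all_analysis.

Set Implicit Arguments.
Unset Strict Implicit.
Unset Printing Implicit Defensive.

Import Order.TTheory GRing.Theory Num.Theory.
Import numFieldNormedType.Exports.

Local Open Scope classical_set_scope.
Local Open Scope ring_scope.

Section iid.
Context {d : measure_display} {T : measurableType d} {R : realType}.
Variables (P : probability T R) (I : choiceType).

Definition mutually_independent (Y : I -> {RV P >-> R}) : Prop :=
  forall (s : seq I) (B : I -> set R), uniq s ->
    (forall i, measurable (B i)) ->
    P (\bigcap_(i in [set` s]) (Y i @^-1` B i)) =
    (\prod_(i <- s) P (Y i @^-1` B i))%E.

(* The laws are compared on Borel sets only: the value of a measure of the
   library on a non-measurable set is unspecified. *)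
Definition identically_distributed (Y : I -> {RV P >-> R}) : Prop :=
  forall (i j : I) (B : set R), measurable B ->
    distribution P (Y i) B = distribution P (Y j) B.

Definition iid (Y : I -> {RV P >-> R}) : Prop :=
  mutually_independent Y /\ identically_distributed Y.

End iid.

Definition random_environment {d : measure_display} {T : measurableType d}
    {R : realType} (P : probability T R) (omega : int -> {RV P >-> R}) : Prop :=
  iid omega /\ (forall x t, 0 < omega x t < 1).

Definition rho {R : realType} (p : R) : R := (1 - p) / p.

Section quenched_walk.
Context {d : measure_display} {T : measurableType d} {R : realType}.
Variable (Q : probability T R).

(* Equal to 0 by convention when Q B = 0; only used when 0 < Q B. *)
Definition cond_prob (A B : set T) : R := fine (Q (A `&` B)) / fine (Q B).

(* Measurability for the discrete sigma-algebra on int. *)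
Definition int_process (X : nat -> T -> int) : Prop :=
  forall n (B : set int), measurable (X n @^-1` B).

Definition markov_property (X : nat -> T -> int) : Prop :=
  forall (n : nat) (p : nat -> int) (z : int),
    let past := [set t | forall k, (k <= n)%N -> X k t = p k] in
    (0 < Q past)%E ->
    cond_prob [set t | X n.+1 t = z] past =
    cond_prob [set t | X n.+1 t = z] [set t | X n t = p n].

Definition walk_in_environment (w : int -> R) (x : int) (X : nat -> T -> int) :
    Prop :=
  [/\ int_process X,
      Q [set t | X 0%N t = x] = 1%E,
      markov_property X &
      forall (n : nat) (y : int), (0 < Q [set t | X n t = y])%E ->
        cond_prob [set t | X n.+1 t = y + 1] [set t | X n t = y] = w y /\
        w y = 1 - cond_prob [set t | X n.+1 t = y - 1] [set t | X n t = y]].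

End quenched_walk.

(* Main.v *)
(* Let V be the potential, with increments ln rho, and pi ~ exp (- V) the
   reversible measure of the walk, normalised by pi 0 = 1. Suppose that V
   reaches the height h at - a and at b, and stays above - delta h in between.
   Kill the walk at - a and at b, and let f_n be the density of its time n law
   with respect to pi. The maximum principle gives f_n <= 1, so the mass killed
   at each step is at most pi (- a) + pi b ~ exp (- h); up to a time of order
   exp h half of the mass survives. By reversibility and Cauchy-Schwarz,
   P (X_2n = 0) >= f_2n 0 = |f_n|^2_pi >= (mass)^2 / pi [-a, b], which is at
   least exp (- 2 delta h) if the valley has width at most exp (delta h). Such
   a valley thus contributes exp ((1 - alpha - 2 delta) h) to the series.

   There are almost surely infinitely many valleys: cut the two half-lines into
   disjoint blocks whose lengths grow so fast that the potential accumulated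
   before a block is negligible. In each block, optional stopping for S_n and
   S_n^2 - n Var bounds from below the probability that the potential climbs by
   2h before it descends by delta h / 2. The blocks are independent, so that the
   second Borel-Cantelli lemma applies. *)

Require Import Defs.
From mathcomp Require Import all_boot all_order all_algebra.
From mathcomp Require Import all_classical all_reals all_analysis.
From mathcomp Require Import measurable_realfun ring lra zify.

Set Implicit Arguments.
Unset Strict Implicit.
Unset Printing Implicit Defensive.

Import Order.TTheory GRing.Theory Num.Theory.
Import numFieldNormedType.Exports.

Local Open Scope classical_set_scope.
Local Open Scope ring_scope.

(** * Divergence of series *)

Lemma nneseries_eqyP (R : realType) (u : nat -> \bar R) (m : nat) :
  (forall n, 0 <= u n)%E ->
  (\sum_(m <= n <oo) u n = +oo)%E <->
  forall A : R, exists N, (A%:E <= \sum_(m <= n < N) u n)%E.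
Proof.
move=> u0; split=> [u_oo A|unbounded].
  have /cvg_ex[l ul] : cvgn (fun N => \sum_(m <= n < N) u n)%E.
    by apply: is_cvg_nneseries => n _ _.
  have := ul; rewrite -(cvg_lim (@ereal_hausdorff R) ul) u_oo.
  by move=> /cvgeyPge/(_ A)[N _ /(_ N (leqnn N))]; exists N.
apply: eq_infty => A; have [N] := unbounded A.
by move/le_trans; apply; apply: nneseries_lim_ge => n _ _.
Qed.

Lemma nneseries_near_ge_eqy (R : realType) (u : nat -> \bar R) (c : R) :
  (forall n, 0 <= u n)%E -> 0 < c -> (\forall n \near \oo, c%:E <= u n)%E ->
  (\sum_(0 <= n <oo) u n = +oo)%E.
Proof.
move=> u0 c0 [n0 _ u_ge]; apply/nneseries_eqyP => // A.
pose N := Num.trunc (`|A| / c); exists (n0 + N.+1)%N.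
rewrite (big_cat_nat (n := n0)) ?leq_addr//=.
apply: (@le_trans _ _ (\sum_(n0 <= n < n0 + N.+1) u n)%E); last first.
  by rewrite leeDr// sume_ge0.
apply: (@le_trans _ _ (\sum_(n0 <= n < n0 + N.+1) c%:E)%E); last first.
  by rewrite big_seq [leRHS]big_seq; apply: lee_sum => n;
    rewrite mem_index_iota => /andP[+ _]; exact: u_ge.
rewrite sumEFin lee_fin sumr_const_nat addKn -mulr_natl -ler_pdivrMr//.
apply: (@le_trans _ _ (`|A| / c)); last exact/ltW/truncnS_gt.
by rewrite ler_wpM2r ?ler_norm// invr_ge0 ltW.
Qed.

Lemma ler_pM_powR (R : realType) (A k g x : R) : 0 < k -> 0 < g ->
  (`|A| / k) `^ g^-1 <= x -> A <= k * x `^ g.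
Proof.
move=> k0 g0 x_ge; rewrite (le_trans (ler_norm A))// mulrC -ler_pdivrMr//.
have -> : `|A| / k = ((`|A| / k) `^ g^-1) `^ g.
  by rewrite -powRrM mulVf ?gt_eqF// powRr1// divr_ge0// ltW.
have x0 : 0 <= x by exact: le_trans (powR_ge0 _ _) x_ge.
by apply: ge0_ler_powR; rewrite ?nnegrE ?powR_ge0 ?(ltW g0).
Qed.

Lemma nneseries_powR_eqy (R : realType) (u : nat -> \bar R) (a b c : R) :
  0 <= a -> a + b < 1 -> 0 < c -> (forall n, 0 <= u n)%E ->
  (forall x0, exists2 x, x0 <= x & forall n, (0 < n)%N -> n%:R <= c * x ->
    ((c * x `^ (- b))%:E <= u n)%E) ->
  (\sum_(1 <= n <oo) (u n * (n%:R `^ (- a))%:E) = +oo)%E.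
Proof.
move=> a0 ab1 c0 u0 windows; apply/nneseries_eqyP => [n|A].
  by rewrite mule_ge0// lee_fin powR_ge0.
pose g := 1 - a - b; pose k := c / 2 * (c * c `^ (- a)).
have g0 : 0 < g by rewrite /g; lra.
have k0 : 0 < k by rewrite !mulr_gt0// powR_gt0.
have [x] := windows (Num.max (2 / c) ((`|A| / k) `^ g^-1)).
rewrite ge_max => /andP[x_ge x_geA] ux.
have cx2 : 2 <= c * x by rewrite mulrC -ler_pdivrMr.
have x0 : 0 < x by rewrite -(pmulr_rgt0 _ c0); lra.
have cx0 : 0 < c * x by exact: mulr_gt0.
pose N := Num.trunc (c * x).
have /andP[N_le ltN] : N%:R <= c * x < N.+1%:R by apply: truncn_itv; exact: ltW.
pose v := c * x `^ (- b) * (c * x) `^ (- a).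
have v0 : 0 <= v by rewrite !mulr_ge0 ?powR_ge0// ltW.
exists N.+1; rewrite big_nat_cond.
apply: (@le_trans _ _
  (\sum_(1 <= n < N.+1 | (1 <= n < N.+1)%N && true) v%:E)%E).
  rewrite -big_nat_cond sumEFin lee_fin sumr_const_nat subn1 /=.
  apply: (@le_trans _ _ (c * x / 2 * v)); last first.
    rewrite -[leRHS]mulr_natl ler_wpM2r//.
    by move: ltN; rewrite -[N.+1%:R]natr1; lra.
  have -> : c * x / 2 * v = k * x `^ g.
    rewrite /v /k powRM ?ltW// /g !powRD ?(gt_eqF x0) ?implybT//.
    by rewrite powRr1 ?ltW//; field.
  exact: ler_pM_powR.
apply: lee_sum => n /andP[/andP[n1 nN] _]; rewrite EFinM.
have n_le : n%:R <= c * x by apply: le_trans N_le; rewrite ler_nat -ltnS.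
apply: lee_pmul; rewrite ?lee_fin ?mulr_ge0 ?powR_ge0 ?(ltW c0)//.
  exact: ux.
rewrite !powRN lef_pV2 ?posrE ?powR_gt0 ?ltr0n//.
by apply: ge0_ler_powR; rewrite ?nnegrE ?(ltW cx0).
Qed.

(** * Independence *)

Lemma measurable_preimageT (d d' : measure_display) (T : measurableType d)
    (T' : measurableType d') (f : T -> T') (A : set T') :
  measurable_fun setT f -> measurable A -> measurable (f @^-1` A).
Proof. by move=> mf mA; rewrite -[_ @^-1` _]setTI; exact: mf. Qed.

Section independent_set_systems.
Context {d : measure_display} {T : measurableType d} {R : realType}.
Variable P : probability T R.
Implicit Types F G : set_system T.

Definition independent_systems F G : Prop :=
  forall A B, F A -> G B -> P (A `&` B) = (P A * P B)%E.

Definition independent_RV (X Z : T -> R) : Prop :=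
  forall A B, measurable A -> measurable B ->
    P (X @^-1` A `&` Z @^-1` B) = (P (X @^-1` A) * P (Z @^-1` B))%E.

Definition independent_events (J : choiceType) (E : J -> set T) : Prop :=
  forall s : seq J, uniq s ->
    P (\bigcap_(j in [set` s]) E j) = (\prod_(j <- s) P (E j))%E.

Lemma independent_RV_comp (X Z : T -> R) (f g : R -> R) :
  measurable_fun setT f -> measurable_fun setT g ->
  independent_RV X Z -> independent_RV (f \o X) (g \o Z).
Proof.
move=> mf mg XZ A B mA mB.
exact: (XZ _ _ (measurable_preimageT mf mA) (measurable_preimageT mg mB)).
Qed.

Lemma independent_systemsC F G :
  independent_systems F G -> independent_systems G F.
Proof. by move=> FG A B GA FB; rewrite setIC muleC; exact: FG. Qed.

Lemma independent_systems_sigmar F G : F `<=` measurable ->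
  G `<=` measurable -> setI_closed G ->
  independent_systems F G -> independent_systems F <<s G >>.
Proof.
move=> mF mG GI FG A B FA; have mA := mF _ FA.
have PA_fin : P A \is a fin_num by exact: fin_num_measure.
pose PA := NngNum (fine_ge0 (measure_ge0 P A)).
rewrite -(fineK PA_fin) setIC -[LHS]/(mrestr P mA B) -[RHS]/(mscale PA P B).
have trace : [set X | G X /\ X `<=` setT] = G.
  by apply/seteqP; split => [X []|X GX].
rewrite -trace.
apply: (g_sigma_algebra_measure_unique_trace G setT measurableT);
  rewrite ?trace//.
- by rewrite /= /mrestr /mscale /= setTI probability_setT mule1 fineK.
- by move=> X GX; rewrite /= /mrestr /mscale /= fineK// setIC; exact: FG.
- by rewrite /= /mrestr /= setTI ltey_eq PA_fin.
Qed.

Lemma independent_systems_sigma F G : F `<=` measurable -> G `<=` measurable ->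
  setI_closed F -> setI_closed G ->
  independent_systems F G -> independent_systems <<s F >> <<s G >>.
Proof.
move=> mF mG FI GI FG; apply/independent_systemsC.
apply: independent_systems_sigmar => //.
  exact: smallest_sub (@sigma_algebra_measurable _ T) mG.
by apply/independent_systemsC; exact: independent_systems_sigmar.
Qed.

End independent_set_systems.

Section coordinate_sigma_algebras.
Context {d : measure_display} {T : measurableType d} {R : realType}.
Variables (P : probability T R) (I : choiceType) (Y : I -> {RV P >-> R}).
Implicit Types (D : set I) (B : I -> set R).

Definition cylinder B : set T := \bigcap_i (Y i @^-1` B i).

Definition box (s : seq I) B : Prop :=
  (forall i, measurable (B i)) /\ forall i, i \notin s -> B i = setT.

Definition cylinders D : set_system T :=
  [set cylinder B | B in
    [set B | exists2 s : seq I, [set` s] `<=` D & box s B]].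

Lemma cylinderE s B : box s B ->
  cylinder B = \bigcap_(i in [set` s]) (Y i @^-1` B i).
Proof.
move=> [_ BT]; apply/seteqP; split => t cyl i; first by move=> _; exact: cyl.
by move=> _; have [/cyl//|/BT ->] := boolP (i \in s).
Qed.

Lemma cylinderI B C :
  cylinder B `&` cylinder C = cylinder (fun i => B i `&` C i).
Proof. by rewrite /cylinder -bigcapI. Qed.

Lemma boxI s1 s2 B C : box s1 B -> box s2 C ->
  box (s1 ++ s2) (fun i => B i `&` C i).
Proof.
move=> [mB BT] [mC CT]; split=> i; first exact: measurableI.
by rewrite mem_cat negb_or => /andP[/BT -> /CT ->]; rewrite setIT.
Qed.

Lemma cylinders_measurable D : cylinders D `<=` measurable.
Proof.
move=> _ [B [s _ sB] <-]; rewrite (cylinderE sB).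
apply: fin_bigcap_measurable => // i _.
by apply: measurable_funPTI; apply: sB.1.
Qed.

Lemma cylinders_setI_closed D : setI_closed (cylinders D).
Proof.
move=> _ _ [B [s1 s1D sB] <-] [C [s2 s2D sC] <-]; rewrite cylinderI.
exists (fun i => B i `&` C i) => //; exists (s1 ++ s2); last exact: boxI.
by move=> i /=; rewrite mem_cat => /orP[/s1D|/s2D].
Qed.

Lemma subset_cylinders D D' : D `<=` D' -> cylinders D `<=` cylinders D'.
Proof.
move=> DD' _ [B [s sD sB] <-]; exists B => //; exists s => //.
exact: subset_trans sD DD'.
Qed.

Lemma sigma_cylinders_measurable D : <<s cylinders D >> `<=` measurable.
Proof.
exact: smallest_sub (@sigma_algebra_measurable _ T) (@cylinders_measurable D).
Qed.

Lemma subset_sigma_cylinders D D' :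
  D `<=` D' -> <<s cylinders D >> `<=` <<s cylinders D' >>.
Proof. by move=> DD'; apply: sub_sigma_algebra2; exact: subset_cylinders. Qed.

Hypothesis indepY : mutually_independent Y.

Lemma probability_cylinder s B : box s B ->
  P (cylinder B) = (\prod_(i <- undup s) P (Y i @^-1` B i))%E.
Proof.
move=> sB; rewrite (cylinderE sB) -(indepY (undup_uniq s) sB.1).
congr (P (\bigcap_(i in _) _)).
by apply/seteqP; split => i /=; rewrite mem_undup.
Qed.

Lemma independent_cylinders D1 D2 : D1 `&` D2 = set0 ->
  independent_systems P (cylinders D1) (cylinders D2).
Proof.
move=> D12 _ _ [B [s1 s1D sB] <-] [C [s2 s2D sC] <-].
rewrite cylinderI (probability_cylinder (boxI sB sC)).
rewrite (probability_cylinder sB) (probability_cylinder sC).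
have disj i : i \in s1 -> i \notin s2.
  move=> is1; apply/negP => is2.
  by have : (D1 `&` D2) i by [split; [exact: s1D|exact: s2D]]; rewrite D12.
have -> : undup (s1 ++ s2) = undup s1 ++ undup s2.
  rewrite undup_cat; congr (_ ++ _); apply/all_filterP/allP => i.
  by rewrite mem_undup; exact: disj.
rewrite big_cat; congr (_ * _)%E; rewrite big_seq [RHS]big_seq;
  apply: eq_bigr => i; rewrite mem_undup => is_.
- by rewrite (sC.2 _ (disj _ is_)) setIT.
- by rewrite (sB.2 i) ?setTI//; apply/negP => /disj; rewrite is_.
Qed.

Lemma independent_sigma_cylinders D1 D2 : D1 `&` D2 = set0 ->
  independent_systems P <<s cylinders D1 >> <<s cylinders D2 >>.
Proof.
move=> D12; apply: independent_systems_sigma.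
- exact: cylinders_measurable.
- exact: cylinders_measurable.
- exact: cylinders_setI_closed.
- exact: cylinders_setI_closed.
- exact: independent_cylinders.
Qed.

Definition depends_on D (f : T -> R) : Prop :=
  measurable_fun [set: g_sigma_algebraType (cylinders D)] f.

Lemma depends_on_preimage D f (A : set R) :
  depends_on D f -> measurable A -> <<s cylinders D >> (f @^-1` A).
Proof. exact: measurable_preimageT. Qed.

Lemma subset_depends_on D D' f : D `<=` D' -> depends_on D f -> depends_on D' f.
Proof.
move=> DD' Df _ A mA; rewrite setTI.
exact: subset_sigma_cylinders DD' _ (depends_on_preimage Df mA).
Qed.

Lemma depends_on_coordinate i : depends_on [set i] (Y i).
Proof.
move=> _ A mA; rewrite setTI; apply: sub_sigma_algebra.
exists (fun j => if j == i then A else setT).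
  exists [:: i]; first by move=> j /=; rewrite mem_seq1 => /eqP.
  split=> j; first by case: ifP.
  by rewrite mem_seq1 => /negbTE ->.
apply/seteqP; split => t; first by move/(_ i Logic.I) => /=; rewrite eqxx.
by move=> Yt j _ /=; case: eqP => // ->.
Qed.

Lemma independent_RV_disjoint D1 D2 f1 f2 : D1 `&` D2 = set0 ->
  depends_on D1 f1 -> depends_on D2 f2 -> independent_RV P f1 f2.
Proof.
move=> D12 Df1 Df2 A B mA mB; apply: (independent_sigma_cylinders D12);
  exact: depends_on_preimage.
Qed.

Lemma independent_events_disjoint (J : choiceType) (D : J -> set I)
    (E : J -> set T) : trivIset setT D ->
  (forall j, <<s cylinders (D j) >> (E j)) -> independent_events P E.
Proof.
move=> tD DE; elim=> [_|j s IH /= /andP[js us]].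
  by rewrite set_nil bigcap_set0 big_nil probability_setT.
rewrite bigcap_seq !big_cons -bigcap_seq -IH//.
have disj : D j `&` \bigcup_(k in [set` s]) D k = set0.
  apply/seteqP; split => // x [Djx [k /= ks Dkx]].
  have jk : j = k by apply: (tD j k) => //; exists x.
  by rewrite jk ks in js.
apply: independent_sigma_cylinders disj _ _ (DE j) _.
apply: (@fin_bigcap_measurable _ (g_sigma_algebraType _)) => // k ks.
by apply: subset_sigma_cylinders (DE k); exact: bigcup_sup.
Qed.

End coordinate_sigma_algebras.

Arguments depends_on_coordinate {d T R P I} Y i.

Section independent_events_theory.
Context {d : measure_display} {T : measurableType d} {R : realType}.
Variable P : probability T R.

Lemma independent_events_mixed (J : choiceType) (E : J -> set T) (s r : seq J) :
  (forall j, measurable (E j)) -> independent_events P E -> uniq (r ++ s) ->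
  P (\bigcap_(j in [set` s]) ~` E j `&` \bigcap_(j in [set` r]) E j) =
  (\prod_(j <- s) P (~` E j) * \prod_(j <- r) P (E j))%E.
Proof.
move=> mE indepE.
have mcap (F : J -> set T) (q : seq J) : (forall j, measurable (F j)) ->
    measurable (\bigcap_(j in [set` q]) F j).
  by move=> mF; exact: fin_bigcap_measurable.
have prod_fin (F : J -> set T) (q : seq J) : (forall j, measurable (F j)) ->
    (\prod_(j <- q) P (F j))%E \is a fin_num.
  move=> mF; apply: (big_ind (fun x => x \is a fin_num)) => // [x y|j _].
    exact: fin_numM.
  exact: fin_num_measure.
elim: s r => [r|j s IH r u].
  by rewrite cats0 set_nil bigcap_set0 setTI big_nil mul1e; exact: indepE.
have u_jr : uniq (j :: r ++ s).
  by rewrite -[j :: _]/([:: j] ++ r ++ s) uniq_catCA.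
have u_r : uniq (r ++ s) by case/andP: u_jr.
have capS (F : J -> set T) (q : seq J) : \bigcap_(i in [set` j :: q]) F i =
    F j `&` \bigcap_(i in [set` q]) F i.
  by rewrite bigcap_seq big_cons -bigcap_seq.
have := IH (j :: r) u_jr; have := IH r u_r.
rewrite !capS !big_cons setICA -setIA [~` _ `&` _]setIC -setDE.
set A := _ `&` \bigcap_(i in [set` r]) _ => PA PAEj.
have mA : measurable A.
  by apply: measurableI; apply: mcap => // i; exact: measurableC.
have -> : P (A `\` E j) = (P A - P (E j `&` A))%E.
  by rewrite [E j `&` A]setIC measureD ?ltey_eq ?fin_num_measure.
rewrite PA PAEj probability_setC//.
have : P (E j) \is a fin_num by exact: fin_num_measure.
have := prod_fin E r mE.
have := prod_fin (fun i => ~` E i) s (fun i => measurableC (mE i)).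
case: (\prod_(i <- s) _)%E => // a _; case: (\prod_(i <- r) _)%E => // b _.
case: (P (E j)) => // e _.
by rewrite -!EFinM -!EFinB; congr EFin; ring.
Qed.

Lemma independent_eventsC (J : choiceType) (E : J -> set T) :
  (forall j, measurable (E j)) -> independent_events P E ->
  independent_events P (fun j => ~` E j).
Proof.
move=> mE indepE s us.
have := independent_events_mixed (r := [::]) mE indepE us.
by rewrite set_nil bigcap_set0 setIT big_nil mule1.
Qed.

Lemma probability_bigcap_setC_le (E : (set T)^nat) (n N : nat) :
  (forall k, measurable (E k)) -> independent_events P E ->
  fine (P (\bigcap_(k in [set` index_iota n N]) ~` E k)) *
    (1 + \sum_(n <= k < N) fine (P (E k))) <= 1.
Proof.
move=> mE indepE; set s := \sum_(_ <= _ < _) _.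
have -> : P (\bigcap_(k in [set` index_iota n N]) ~` E k) =
    (\prod_(n <= k < N) (1 - fine (P (E k))))%:E.
  rewrite (independent_eventsC mE indepE) ?iota_uniq// -prodEFin.
  apply: eq_bigr => k _.
  by rewrite probability_setC// EFinB fineK ?fin_num_measure.
have s0 : 0 <= s by apply: sumr_ge0 => k _; rewrite fine_ge0.
have prod_le : \prod_(n <= k < N) (1 - fine (P (E k))) <= expR (- s).
  rewrite -sumrN expR_sum; apply: ler_prod => k _; rewrite subr_ge0.
  rewrite expR_ge1Dx andbT -lee_fin fineK ?fin_num_measure//.
  exact: probability_le1.
apply: (@le_trans _ _ (expR (- s) * expR s)); last first.
  by rewrite expRN mulVf ?gt_eqF ?expR_gt0.
apply: ler_pM => //; last exact: expR_ge1Dx.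
  apply: prodr_ge0 => k _; rewrite subr_ge0 -lee_fin fineK ?fin_num_measure//.
  exact: probability_le1.
by rewrite addr_ge0.
Qed.

Lemma second_Borel_Cantelli (E : (set T)^nat) :
  (forall k, measurable (E k)) -> independent_events P E ->
  (\sum_(0 <= k <oo) P (E k) = +oo)%E -> \forall t \ae P, lim_sup_set E t.
Proof.
move=> mE indepE series_oo; apply: ae_foralln => n.
pose A := \bigcap_(k in [set k | (n <= k)%N]) ~` E k.
have mA : measurable A.
  by apply: bigcap_measurableType => k _; exact: measurableC.
suff PA0 : fine (P A) = 0.
  exists A; split => // [|t /= never k /= nk Ekt].
    by rewrite -[LHS]fineK ?fin_num_measure// PA0.
  by apply: never; exists k.
have tail_oo : (\sum_(n <= k <oo) P (E k) = +oo)%E.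
  have : (\sum_(0 <= k < n) P (E k))%E \is a fin_num.
    by apply/sum_fin_numP => k _ _; exact: fin_num_measure.
  move: series_oo; rewrite (nneseries_split 0 n)//= add0n.
  by case: (\sum_(0 <= k < n) _)%E => // s; case: (\sum_(n <= k <oo) _)%E.
apply/eqP; rewrite eq_le fine_ge0// andbT leNgt; apply/negP => PA_gt0.
have /nneseries_eqyP := tail_oo; move=> /(_ (fun k => measure_ge0 P (E k))).
move=> /(_ (fine (P A))^-1)[N].
rewrite (eq_bigr (fun k => (fine (P (E k)))%:E)) => [|k _]; last first.
  by rewrite fineK ?fin_num_measure.
rewrite sumEFin lee_fin => sum_ge.
have := probability_bigcap_setC_le n N mE indepE; apply/negP; rewrite -ltNge.
apply: (@lt_le_trans _ _ (fine (P A) * (1 + (fine (P A))^-1))).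
  by rewrite mulrDr divff ?gt_eqF// mulr1 ltrDr.
apply: ler_pM; rewrite ?addr_ge0 ?invr_ge0 ?fine_ge0 ?lerD2l//.
have mB : measurable (\bigcap_(k in [set` index_iota n N]) ~` E k).
  by apply: fin_bigcap_measurable => // k _; exact: measurableC.
apply: fine_le; rewrite ?fin_num_measure//.
apply: le_measure; rewrite ?inE// => t never k /=.
by rewrite mem_index_iota => /andP[nk _]; exact: never.
Qed.

End independent_events_theory.

Lemma mutually_independent_comp (d : measure_display) (T : measurableType d)
    (R : realType) (P : probability T R) (I J : choiceType)
    (Y : I -> {RV P >-> R}) (Z : J -> {RV P >-> R})
    (phi : J -> I) (f : J -> R -> R) :
  injective phi -> (forall j, measurable_fun setT (f j)) ->
  (forall j t, Z j t = f j (Y (phi j) t)) ->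
  mutually_independent Y -> mutually_independent Z.
Proof.
move=> phi_inj mf ZE indepY s B us mB.
pose C i : set R := [set u | forall j, phi j = i -> B j (f j u)].
have CE j : C (phi j) = f j @^-1` B j.
  by apply/seteqP; split => [u|u Bfu k /phi_inj ->//]; exact.
have mC i : measurable (C i).
  have [[j <-]|noj] := pselect (exists j, phi j = i).
    by rewrite CE; exact: measurable_preimageT.
  rewrite (_ : C i = setT)//; apply/seteqP; split => // u _ j ji.
  by case: noj; exists j.
have ZC j : Z j @^-1` B j = Y (phi j) @^-1` C (phi j).
  by rewrite CE; apply/seteqP; split => t /=; rewrite ZE.
have := indepY (map phi s) C; rewrite map_inj_uniq// => /(_ us mC).
rewrite !bigcap_seq !big_map => indepC.
rewrite (eq_bigr _ (fun j _ => ZC j)) indepC.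
by apply: eq_bigr => j _; rewrite ZC.
Qed.

Section integral_product.
Local Open Scope ereal_scope.
Context {d1 d2 : measure_display} {T1 : measurableType d1}
  {T2 : measurableType d2} {R : realType}.
Variables (m1 : {sigma_finite_measure set T1 -> \bar R})
  (m2 : {sigma_finite_measure set T2 -> \bar R}) (f : T1 -> R) (g : T2 -> R).
Hypotheses (intf : m1.-integrable setT (EFin \o f))
  (intg : m2.-integrable setT (EFin \o g)).

Let fg (z : T1 * T2) : \bar R := (f z.1 * g z.2)%:E.

Lemma integrable_prodM : (m1 \x m2).-integrable setT fg.
Proof.
have [/integrableP[mf f_fin] /integrableP[mg g_fin]] := (intf, intg).
have {}mf : measurable_fun setT f by exact/measurable_EFinP.
have {}mg : measurable_fun setT g by exact/measurable_EFinP.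
apply/integrable12ltyP.
  apply/measurable_EFinP; apply: measurable_funM.
  - exact: measurableT_comp mf measurable_fst.
  - exact: measurableT_comp mg measurable_snd.
under eq_integral => x _.
  under eq_integral do rewrite /fg /= normrM EFinM.
  rewrite ge0_integralZl//; last first.
    by apply/measurable_EFinP; exact: measurableT_comp.
  over.
rewrite /= ge0_integralZr//; last 2 first.
- by apply/measurable_EFinP; exact: measurableT_comp.
- exact: integral_ge0.
apply: lte_mul_pinfty => //; first exact: integral_ge0.
by rewrite ge0_fin_numE ?integral_ge0.
Qed.

Lemma integral_prodM :
  \int[m1 \x m2]_z fg z = \int[m1]_x (f x)%:E * \int[m2]_y (g y)%:E.
Proof.
rewrite -(integral12_prod_meas1 integrable_prodM).
have g_fin : \int[m2]_y (g y)%:E \is a fin_num by exact: integrable_fin_num.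
under eq_integral => x _.
  rewrite /fubini_F /fg; under eq_integral do rewrite /= EFinM.
  rewrite integralZl// -[integral m2 _ _](fineK g_fin).
  over.
by rewrite integralZr// fineK.
Qed.

End integral_product.

Section expectation_product.
Context {d : measure_display} {T : measurableType d} {R : realType}.
Variable P : probability T R.

Lemma joint_distribution (X Z : {RV P >-> R}) (XZ : {RV P >-> (R * R)%type})
    (C : set (R * R)) :
  independent_RV P X Z -> (forall t, XZ t = (X t, Z t)) -> measurable C ->
  (distribution P X \x distribution P Z)%E C = distribution P XZ C.
Proof.
move=> indepXZ XZE mC; apply: product_measure_unique => // A B mA mB.
rewrite -[RHS]indepXZ//; congr (P _).
by apply/seteqP; split => t /=; rewrite XZE.
Qed.

(* The joint law is a product measure, so that Fubini applies. *)
Lemma Rintegral_independentM (X Z : T -> R) : independent_RV P X Z ->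
  P.-integrable setT (EFin \o X) -> P.-integrable setT (EFin \o Z) ->
  \int[P]_t (X t * Z t) = (\int[P]_t X t) * \int[P]_t Z t.
Proof.
move=> indepXZ intX intZ.
rewrite /Rintegral -fineM; [|exact: integrable_fin_num..].
have mX : measurable_fun setT X.
  by apply/measurable_EFinP; exact: measurable_int intX.
have mZ : measurable_fun setT Z.
  by apply/measurable_EFinP; exact: measurable_int intZ.
pose X' : {RV P >-> R} := mfun_Sub (mem_set mX).
pose Z' : {RV P >-> R} := mfun_Sub (mem_set mZ).
pose XZ : {RV P >-> (R * R)%type} :=
  mfun_Sub (mem_set (measurable_fun_pair mX mZ)).
have mid : measurable_fun setT (EFin \o @id R) by exact/measurable_EFinP.
have intX_id : (distribution P X').-integrable setT (EFin \o @id R).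
  exact: integrable_pushforward.
have intZ_id : (distribution P Z').-integrable setT (EFin \o @id R).
  exact: integrable_pushforward.
have int_joint h : measurable_fun setT h ->
    (\int[distribution P X' \x distribution P Z']_z h z =
     \int[distribution P XZ]_z h z)%E.
  move=> mh; apply: eq_measure_integral => C mC _.
  by apply: joint_distribution.
pose f (z : R * R) : \bar R := (z.1 * z.2)%:E.
have intf := integrable_prodM intX_id intZ_id.
have mf : measurable_fun setT f by exact: measurable_int intf.
have intfXZ : P.-integrable setT (f \o XZ).
  apply/integrableP; split; first exact: measurableT_comp.
  rewrite -[X in (X < _)%E]/(\int[P]_t ((abse \o f) \o XZ) t)%E.
  rewrite -ge0_integral_distribution//; [|exact: measurableT_comp|]; last first.
    by move=> z; exact: abse_ge0.
  rewrite -int_joint; last exact: measurableT_comp.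
  by have /integrableP[_] := intf.
congr fine; rewrite -[LHS]/(\int[P]_t (f \o XZ) t)%E -integral_distribution//.
rewrite -int_joint// (integral_prodM intX_id intZ_id).
by rewrite !integral_distribution.
Qed.

End expectation_product.

Section iid_families.
Context {d : measure_display} {T : measurableType d} {R : realType}.
Variable P : probability T R.

Lemma ae_forall_countable (I : countType) (A : I -> T -> Prop) :
  (forall i, \forall t \ae P, A i t) -> \forall t \ae P, forall i, A i t.
Proof.
move=> aeA.
have aeN n : \forall t \ae P, forall i, unpickle n = Some i -> A i t.
  case: (unpickle n) => [i|]; last exact: aeW.
  by apply: filterS (aeA i) => t Ait _ [<-].
apply: filterS (ae_foralln aeN) => t At i.
exact: At (pickle i) i (pickleK i).
Qed.

Lemma identically_distributed_ae (I : countType) (Y : I -> {RV P >-> R})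
    (i : I) (A : set R) : identically_distributed Y -> measurable A ->
  P (Y i @^-1` A) = 1%E -> \forall t \ae P, forall j, A (Y j t).
Proof.
move=> identY mA PA; apply: ae_forall_countable => j.
have mYA k : measurable (Y k @^-1` A) by exact: measurable_funPTI.
have PjA : P (Y j @^-1` A) = 1%E by rewrite -PA; exact: identY.
exists (~` (Y j @^-1` A)); split => //; first exact: measurableC.
have PC : P (~` (Y j @^-1` A)) = (1 - P (Y j @^-1` A))%E.
  exact: probability_setC.
by rewrite PC PjA subee.
Qed.

Lemma identically_distributed_Rintegral (I : choiceType) (Y : I -> {RV P >-> R})
    (f : R -> R) (i j : I) : identically_distributed Y ->
  measurable_fun setT f ->
  (forall k, P.-integrable setT (EFin \o (f \o Y k))) ->
  \int[P]_t f (Y i t) = \int[P]_t f (Y j t).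
Proof.
move=> identY mf intf; have lawE k : (\int[P]_t (f (Y k t))%:E =
    \int[distribution P (Y k)]_u (f u)%:E)%E.
  by rewrite integral_distribution; [|exact/measurable_EFinP|exact: intf].
rewrite /Rintegral !lawE; congr fine.
by apply: eq_measure_integral => A mA _; exact: identY.
Qed.

End iid_families.

(** * Optional stopping *)

Section bounded_measurable_functions.
Context {d : measure_display} {T : measurableType d} {R : realType}.
Implicit Types f g : T -> R.

Definition bounded_measurable f : Prop :=
  measurable_fun setT f /\ exists K, forall t, `|f t| <= K.

Lemma bounded_measurable_integrable (P : probability T R) f :
  bounded_measurable f -> P.-integrable setT (EFin \o f).
Proof.
move=> [mf [K fK]]; apply: measurable_bounded_integrable => //.
  by rewrite ltey_eq fin_num_measure.
exists K; split; first exact: num_real.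
by move=> x Kx t _ /=; apply: (le_trans (fK t)); exact: ltW.
Qed.

Lemma bounded_measurable_cst c : bounded_measurable (fun=> c).
Proof. by split; [exact: measurable_cst|exists `|c|]. Qed.

Lemma bounded_measurableD f g : bounded_measurable f -> bounded_measurable g ->
  bounded_measurable (fun t => f t + g t).
Proof.
move=> [mf [K fK]] [mg [K' gK]]; split; first exact: measurable_funD.
by exists (K + K') => t; rewrite (le_trans (ler_normD _ _))// lerD.
Qed.

Lemma bounded_measurableM f g : bounded_measurable f -> bounded_measurable g ->
  bounded_measurable (fun t => f t * g t).
Proof.
move=> [mf [K fK]] [mg [K' gK]]; split; first exact: measurable_funM.
by exists (K * K') => t; rewrite normrM ler_pM.
Qed.

Lemma bounded_measurable_indic (A : set T) :
  measurable A -> bounded_measurable \1_A.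
Proof.
move=> mA; split; first exact: measurable_indic.
by exists 1 => t; rewrite indicE ger0_norm ?ler0n// lern1 leq_b1.
Qed.

End bounded_measurable_functions.

Lemma bounded_measurable_comp (d d' : measure_display) (T : measurableType d)
    (T' : measurableType d') (R : realType) (f : T' -> R) (g : T -> T') :
  bounded_measurable f -> measurable_fun setT g -> bounded_measurable (f \o g).
Proof.
move=> [mf [K fK]] mg; split; first exact: measurableT_comp.
by exists K => t; exact: fK.
Qed.

Fixpoint stopped_sum {R : numDomainType} (J : interval R) (x : nat -> R)
    (n : nat) : R :=
  if n is m.+1 then
    let s := stopped_sum J x m in s + (if s \in J then x m else 0)
  else 0.

Section stopped_random_sum.
Context {d : measure_display} {T : measurableType d} {R : realType}.
Variables (P : probability T R) (xi : nat -> T -> R) (B D C s2 : R).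
Hypotheses (B_ge0 : 0 <= B) (D_gt0 : 0 < D).
Hypothesis xi_measurable : forall n, measurable_fun setT (xi n).
Hypothesis xi_le : forall n t, `|xi n t| <= C.

Let J := `]- D, B[.
Let W n t := stopped_sum J (xi ^~ t) n.
Let alive : R -> R := \1_[set` J].

Let aliveE x : alive x = (x \in J)%:R.
Proof. by rewrite /alive indicE mem_setE. Qed.

Let C_ge0 : 0 <= C.
Proof. exact: le_trans (normr_ge0 _) (xi_le 0 point). Qed.

Let WS n t : W n.+1 t = W n t + alive (W n t) * xi n t.
Proof. by rewrite aliveE /W /=; case: ifP; rewrite ?mul1r ?mul0r. Qed.

Lemma stopped_sum_bound n t : - (D + C) <= W n t <= B + C.
Proof.
have [[B0 D0] C0] := (B_ge0, D_gt0, C_ge0).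
elim: n => [|n IH]; first by rewrite /W /=; apply/andP; split; lra.
rewrite /W /= -/(W n t) in_itv /=.
case: ifP => [inside|_]; last by rewrite addr0.
by have := xi_le n t; rewrite ler_norml; lra.
Qed.

Let alive_bounded : bounded_measurable alive.
Proof. by apply: bounded_measurable_indic; exact: measurable_itv. Qed.

Let alive_measurable : measurable_fun setT alive.
Proof. by case: alive_bounded. Qed.

Let W_measurable n : measurable_fun setT (W n).
Proof.
elim: n => [|n IH]; first exact: measurable_cst.
rewrite (_ : W n.+1 = fun t => W n t + alive (W n t) * xi n t).
  apply: measurable_funD => //; apply: measurable_funM => //.
  exact: measurableT_comp.
by apply/funext => t; exact: WS.
Qed.

Let xi_bounded n : bounded_measurable (xi n).
Proof. by split=> //; exists C. Qed.

Let W_norm_le n t : `|W n t| <= B + D + C.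
Proof.
have [[B0 D0] C0] := (B_ge0, D_gt0, C_ge0).
have := stopped_sum_bound n t; rewrite ler_norml => /andP[? ?].
by apply/andP; split; lra.
Qed.

Let W_bounded n : bounded_measurable (W n).
Proof. by split=> //; exists (B + D + C) => t. Qed.

Let alive_W_bounded n : bounded_measurable (fun t => alive (W n t)).
Proof. exact: bounded_measurable_comp. Qed.

Let alive_prob n := \int[P]_t alive (W n t).
Let up_prob n := fine (P [set t | B <= W n t]).

Let alive_prob_antitone m n : (m <= n)%N -> alive_prob n <= alive_prob m.
Proof.
move=> /subnK <-; elim: (n - m)%N => [//|k IH].
apply: le_trans IH; apply: le_Rintegral => //;
  [exact: bounded_measurable_integrable (alive_W_bounded _)..|].
move=> t _; rewrite addSn WS !aliveE.
case: (boolP (W (k + m) t \in J)) => [_|/negbTE out].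
  by rewrite lern1 leq_b1.
by rewrite mul0r addr0 out.
Qed.

Hypothesis W_xi_independent : forall n, independent_RV P (W n) (xi n).
Hypothesis mean_xi : forall n, \int[P]_t xi n t = 0.
Hypothesis var_xi : forall n, \int[P]_t (xi n t ^+ 2) = s2.

Let Rintegral_W_xiM n (f g : R -> R) :
  measurable_fun setT f -> measurable_fun setT g ->
  bounded_measurable (f \o W n) -> bounded_measurable (g \o xi n) ->
  \int[P]_t (f (W n t) * g (xi n t)) =
  (\int[P]_t f (W n t)) * \int[P]_t g (xi n t).
Proof.
move=> mf mg bf bg.
apply: (@Rintegral_independentM _ _ _ P (f \o W n) (g \o xi n));
  [|exact: bounded_measurable_integrable..].
exact: independent_RV_comp.
Qed.

Lemma stopped_sum_mean n : \int[P]_t W n t = 0.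
Proof.
elim: n => [|n IH]; first by rewrite Rintegral_cst// mul0r.
have alive_xi : bounded_measurable (fun t => alive (W n t) * xi n t).
  exact: bounded_measurableM.
have -> : \int[P]_t W n.+1 t = \int[P]_t (W n t + alive (W n t) * xi n t).
  by apply: eq_Rintegral => t _; exact: WS.
rewrite RintegralD//; [|exact: bounded_measurable_integrable..].
have -> : \int[P]_t (alive (W n t) * xi n t) = alive_prob n * \int[P]_t xi n t.
  exact: (Rintegral_W_xiM (g := id) _ _ (alive_W_bounded n) (xi_bounded n)).
by rewrite IH mean_xi; ring.
Qed.

Lemma stopped_sum_second_moment n :
  \int[P]_t (W n t ^+ 2) = s2 * \sum_(k < n) alive_prob k.
Proof.
elim: n => [|n IH].
  under eq_Rintegral do rewrite expr0n /=.
  by rewrite Rintegral_cst// mul0r big_ord0 mulr0.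
have W2 : bounded_measurable (fun t => W n t ^+ 2).
  exact: bounded_measurableM.
have xi2 : bounded_measurable (fun t => xi n t ^+ 2).
  exact: bounded_measurableM.
pose h x := 2 * (alive x * x).
have mh : measurable_fun setT h.
  by apply: measurable_funM => //; exact: measurable_funM.
have hW : bounded_measurable (h \o W n).
  apply: bounded_measurableM; first exact: bounded_measurable_cst.
  exact: bounded_measurableM (alive_W_bounded n) (W_bounded n).
have hW_xi : bounded_measurable (fun t => h (W n t) * xi n t).
  exact: bounded_measurableM.
have alive_xi2 : bounded_measurable (fun t => alive (W n t) * xi n t ^+ 2).
  exact: bounded_measurableM.
have -> : \int[P]_t (W n.+1 t ^+ 2) = \int[P]_t (W n t ^+ 2 +
    (h (W n t) * xi n t + alive (W n t) * xi n t ^+ 2)).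
  apply: eq_Rintegral => t _; rewrite WS /h aliveE.
  by case: (_ \in _) => /=; ring.
rewrite !RintegralD//; [|exact: bounded_measurable_integrable..|]; last first.
  by apply: bounded_measurable_integrable; exact: bounded_measurableD.
have -> : \int[P]_t (h (W n t) * xi n t) =
    (\int[P]_t h (W n t)) * \int[P]_t xi n t.
  exact: (Rintegral_W_xiM (g := id) _ _ hW (xi_bounded n)).
have -> : \int[P]_t (alive (W n t) * xi n t ^+ 2) =
    alive_prob n * \int[P]_t (xi n t ^+ 2).
  have msqr : measurable_fun setT (fun x : R => x ^+ 2).
    exact: measurable_funX.
  exact: (Rintegral_W_xiM alive_measurable msqr (alive_W_bounded n) xi2).
by rewrite IH mean_xi var_xi big_ord_recr /= -/(alive_prob n); ring.
Qed.

Lemma stopped_sum_alive_le n : 0 < s2 ->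
  n%:R * s2 * alive_prob n <= (B + D + C) ^+ 2.
Proof.
move=> s2_gt0; apply: (@le_trans _ _ (\int[P]_t (W n t ^+ 2))).
  rewrite stopped_sum_second_moment [n%:R * _]mulrC -mulrA ler_pM2l//.
  rewrite -[n in n%:R]card_ord mulr_natl -sumr_const.
  by apply: ler_sum => k _; apply: alive_prob_antitone; exact: ltnW.
have PT : fine (P setT) = 1 by rewrite probability_setT.
rewrite -[leRHS]mulr1 -PT -Rintegral_cst//; apply: le_Rintegral => //.
- by apply: bounded_measurable_integrable; exact: bounded_measurableM.
- by apply: bounded_measurable_integrable; exact: bounded_measurable_cst.
move=> t _; rewrite -[leLHS]real_normK ?num_real//.
by rewrite lerXn2r ?nnegrE// (le_trans (normr_ge0 _) (W_norm_le n t)).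
Qed.

Lemma stopped_sum_drift n :
  D <= (B + D + C) * up_prob n + (B + D) * alive_prob n.
Proof.
have mA : measurable [set t | B <= W n t].
  rewrite -preimage_itvcy.
  exact: measurable_preimageT (W_measurable n) (measurable_itv _).
pose up := \1_[set t | B <= W n t] : T -> R.
have upE : up_prob n = \int[P]_t up t.
  by rewrite /Rintegral integral_indic// setIT.
have b_up : bounded_measurable (fun t => (B + D + C) * up t).
  apply: bounded_measurableM; first exact: bounded_measurable_cst.
  exact: bounded_measurable_indic.
have b_alive : bounded_measurable (fun t => (B + D) * alive (W n t)).
  by apply: bounded_measurableM => //; exact: bounded_measurable_cst.
have b_sum := bounded_measurableD b_up b_alive.
have b_cst := bounded_measurable_cst (T := T) (- D).
have PT : fine (P setT) = 1 by rewrite probability_setT.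
have : \int[P]_t W n t <=
    \int[P]_t ((B + D + C) * up t + (B + D) * alive (W n t) + - D).
  apply: le_Rintegral => //; [exact: bounded_measurable_integrable|..].
    by apply: bounded_measurable_integrable; exact: bounded_measurableD.
  move=> t _; have [[B0 D0] C0] := (B_ge0, D_gt0, C_ge0).
  have /andP[Wl Wu] := stopped_sum_bound n t.
  rewrite aliveE /up indicE in_itv /=; have [BW|WB] := leP B (W n t).
    by rewrite mem_set// andbF /=; lra.
  rewrite memNset/=; last by apply/negP; rewrite -ltNge.
  by rewrite andbT; case: ltP => /=; lra.
rewrite stopped_sum_mean !RintegralD//;
  [|exact: bounded_measurable_integrable..].
rewrite !RintegralZl//; last 2 first.
- exact/bounded_measurable_integrable/alive_W_bounded.
- exact/bounded_measurable_integrable/bounded_measurable_indic.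
by rewrite Rintegral_cst// PT -upE -/(alive_prob n); lra.
Qed.

Lemma stopped_sum_upcrossing n : 0 < s2 ->
  (B + D) * (B + D + C) ^+ 2 <= D / 2 * (n%:R * s2) ->
  D / 2 <= (B + D + C) * up_prob n.
Proof.
move=> s2_gt0 n_large; have [[B0 D0] C0] := (B_ge0, D_gt0, C_ge0).
have BD0 : 0 < B + D by rewrite ltr_wpDl.
have ns2 : 0 < n%:R * s2.
  rewrite -(pmulr_rgt0 _ (_ : 0 < D / 2)) ?divr_gt0//.
  by apply: lt_le_trans n_large; rewrite mulr_gt0// exprn_gt0// ltr_wpDr.
have alive_small : (B + D) * alive_prob n <= D / 2.
  rewrite -(ler_pM2l ns2) mulrCA [leRHS]mulrC; apply: le_trans n_large.
  by rewrite ler_pM2l// stopped_sum_alive_le.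
by have := stopped_sum_drift n; lra.
Qed.

End stopped_random_sum.

(** * The walk killed outside an interval *)

Section killed_walk.
Variables (R : realFieldType) (p pi : nat -> R) (L : nat).
Implicit Types f g : nat -> R.

Definition walk_step f (i : nat) : R := p i * f i.+1 + (1 - p i) * f i.-1.

Definition killed_step f (i : nat) : R :=
  if (0 < i < L)%N then walk_step f i else 0.

Definition vanishes_outside f := forall i, ~~ (0 < i < L)%N -> f i = 0.

Definition pi_dot f g := \sum_(i < L.+1) pi i * (f i * g i).

Definition pi_mass f := \sum_(i < L.+1) pi i * f i.

Lemma pi_dotC f g : pi_dot f g = pi_dot g f.
Proof. by apply: eq_bigr => i _; rewrite [f i * _]mulrC. Qed.

Lemma pi_dot1 f : pi_dot f (fun=> 1) = pi_mass f.
Proof. by apply: eq_bigr => i _; rewrite mulr1. Qed.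

Lemma walk_step1 : walk_step (fun=> 1) = fun=> 1.
Proof. by apply/funext => i; rewrite /walk_step; ring. Qed.

Lemma killed_step_vanishes f : vanishes_outside (killed_step f).
Proof. by move=> i /negbTE out; rewrite /killed_step out. Qed.

Lemma pi_dot_killed_step f g : vanishes_outside f ->
  pi_dot f (killed_step g) = pi_dot f (walk_step g).
Proof.
move=> f0; apply: eq_bigr => i _; rewrite /killed_step.
by case: ifPn => // /f0 ->; rewrite !mul0r.
Qed.

Lemma pi_mass_Cauchy_Schwarz f : (forall i, 0 <= pi i) ->
  0 < \sum_(i < L.+1) pi i ->
  pi_mass f ^+ 2 <= (\sum_(i < L.+1) pi i) * pi_dot f f.
Proof.
set S := \sum_(i < _) _ => pi0 S0.
have : 0 <= \sum_(i < L.+1) pi i * (S * f i - pi_mass f) ^+ 2.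
  by apply: sumr_ge0 => i _; rewrite mulr_ge0// sqr_ge0.
have -> : \sum_(i < L.+1) pi i * (S * f i - pi_mass f) ^+ 2 =
    S ^+ 2 * pi_dot f f - 2 * S * pi_mass f * pi_mass f + pi_mass f ^+ 2 * S.
  rewrite [X in _ - X]mulr_sumr [X in X - _]mulr_sumr [X in _ + X]mulr_sumr.
  by rewrite -sumrB -big_split /=; apply: eq_bigr => i _; ring.
rewrite (_ : _ + _ = S * (S * pi_dot f f - pi_mass f ^+ 2)); last by ring.
by rewrite pmulr_rge0// subr_ge0.
Qed.

Hypotheses (p01 : forall i, 0 <= p i <= 1) (pi_ge0 : forall i, 0 <= pi i).
Hypothesis balance : forall i, pi i * p i = pi i.+1 * (1 - p i.+1).

Lemma pi_dot_walk_step f g : vanishes_outside f ->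
  pi_dot f (walk_step g) =
  \sum_(i < L) pi i * p i * (f i * g i.+1 + f i.+1 * g i).
Proof.
move=> f0.
have -> : pi_dot f (walk_step g) = \sum_(i < L.+1)
    (pi i * p i * (f i * g i.+1) + pi i * (1 - p i) * (f i * g i.-1)).
  by apply: eq_bigr => i _; rewrite /walk_step; ring.
rewrite big_split /= big_ord_recr /= (f0 L) ?ltnn ?andbF//.
rewrite [X in _ + X]big_ord_recl (f0 ord0)// !mul0r !mulr0 addr0 add0r.
by rewrite -big_split /=; apply: eq_bigr => i _; rewrite balance; ring.
Qed.

Lemma killed_step_selfadjoint f g : vanishes_outside f -> vanishes_outside g ->
  pi_dot f (killed_step g) = pi_dot (killed_step f) g.
Proof.
move=> f0 g0; rewrite [RHS]pi_dotC !pi_dot_killed_step// !pi_dot_walk_step//.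
by apply: eq_bigr => i _; ring.
Qed.

(* Only the edges at the two ends of the interval lose mass. *)
Lemma pi_mass_killed_step f : (0 < L)%N -> vanishes_outside f ->
  pi_mass f = pi_mass (killed_step f) + pi 0%N * p 0%N * f 1%N +
              pi L * (1 - p L) * f L.-1.
Proof.
move=> L0 f0; pose one i : R := (0 < i < L)%N%:R.
have one0 : vanishes_outside one by move=> i /negbTE out; rewrite /one out.
have -> : pi_mass (killed_step f) = pi_dot one (walk_step f).
  apply: eq_bigr => i _; rewrite /one /killed_step.
  by case: ifP => _; rewrite ?mul1r ?mul0r.
rewrite -pi_dot1 -walk_step1 !pi_dot_walk_step// -addrA; apply/eqP.
rewrite addrC -subr_eq -sumrB; apply/eqP.
transitivity (\sum_(i < L) pi i * p i * ((1 - one i) * f i.+1) +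
              \sum_(i < L) pi i * p i * ((1 - one i.+1) * f i)).
  by rewrite -big_split /=; apply: eq_bigr => i _; ring.
case: (L) L0 @one {one0 f0} => // l _ one; congr (_ + _).
- rewrite big_ord_recl big1 => [|i _]; first by rewrite /one /=; ring.
  by rewrite /one lift0 /= ltnS ltn_ord subrr mul0r mulr0.
- rewrite big_ord_recr big1 => [|i _] /=.
    by rewrite /one ltnn balance /=; ring.
  by rewrite /one /= ltnS ltn_ord subrr mul0r mulr0.
Qed.

Lemma pi_mass_killed_step_ge f : (0 < L)%N -> vanishes_outside f ->
  (forall i, f i <= 1) ->
  pi_mass f - (pi 0%N + pi L) <= pi_mass (killed_step f).
Proof.
move=> L0 f0 f1; rewrite (pi_mass_killed_step L0 f0).
have loss x q i : 0 <= x -> 0 <= q -> q <= 1 -> x * q * f i <= x.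
  move=> x0 q0 q1; apply: (@le_trans _ _ (x * q)); last exact: ler_piMr.
  by rewrite ler_piMr// mulr_ge0.
have [/andP[pl0 pl1] /andP[pr0 pr1]] := (p01 0%N, p01 L).
have left_loss := loss _ _ 1%N (pi_ge0 0%N) pl0 pl1.
have right_loss : pi L * (1 - p L) * f L.-1 <= pi L by apply: loss => //; lra.
by lra.
Qed.

Variable o : nat.
Hypotheses (o_inside : (0 < o < L)%N) (pi_o : pi o = 1).

Definition killed_heat (n : nat) : nat -> R :=
  iter n killed_step (fun i => (i == o)%:R).

Let L_gt0 : (0 < L)%N.
Proof. by case/andP: o_inside => o0; exact: leq_trans. Qed.

Let o_ord : 'I_L.+1 := inord o.

Let o_ordE : o_ord = o :> nat.
Proof. by rewrite inordK//; case/andP: o_inside => _ /ltnW. Qed.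

Lemma killed_heat_vanishes n : vanishes_outside (killed_heat n).
Proof.
case: n => [|n] i out /=; last exact: killed_step_vanishes.
by case: eqP out => // ->; rewrite o_inside.
Qed.

Lemma killed_heat01 n i : 0 <= killed_heat n i <= 1.
Proof.
elim: n i => [|n IH] i /=; first by rewrite ler0n lern1 leq_b1.
rewrite /killed_step; case: ifP => _; last by rewrite lexx ler01.
rewrite /walk_step; move: (IH i.+1) (IH i.-1) (p01 i).
move: (killed_heat n i.+1) (killed_heat n i.-1) => a b.
by move=> ? ? ?; apply/andP; split; nra.
Qed.

Lemma pi_dot_heat n m k :
  pi_dot (killed_heat (n + m)) (killed_heat k) =
  pi_dot (killed_heat n) (killed_heat (m + k)).
Proof.
elim: m n => [|m IH] n; first by rewrite addn0.
rewrite addnS -addSn IH /= killed_step_selfadjoint//;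
  exact: killed_heat_vanishes.
Qed.

Lemma killed_heat_diag n :
  killed_heat (n + n) o = pi_dot (killed_heat n) (killed_heat n).
Proof.
rewrite -{4}(addn0 n) -pi_dot_heat /pi_dot (bigD1 o_ord) //= o_ordE.
rewrite pi_o eqxx mulr1 mul1r big1 ?addr0// => i.
by rewrite -val_eqE /= o_ordE => /negbTE ->; rewrite !mulr0.
Qed.

Lemma pi_mass_heat n : 1 - n%:R * (pi 0%N + pi L) <= pi_mass (killed_heat n).
Proof.
elim: n => [|n IH].
  rewrite mul0r subr0 /pi_mass (bigD1 o_ord) //= o_ordE eqxx pi_o mulr1.
  by rewrite lerDl sumr_ge0// => i _; rewrite mulr_ge0.
have := pi_mass_killed_step_ge L_gt0 (killed_heat_vanishes n)
  (fun i => proj2 (andP (killed_heat01 n i))).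
by apply: le_trans; rewrite -natr1; lra.
Qed.

Lemma killed_heat_diag_ge n : n%:R * (pi 0%N + pi L) <= 1 / 2 ->
  1 <= 4 * (\sum_(i < L.+1) pi i) * killed_heat (n + n) o.
Proof.
move=> short; rewrite killed_heat_diag -mulrA.
have pi_gt0 : 0 < \sum_(i < L.+1) pi i.
  rewrite (bigD1 o_ord) //= o_ordE pi_o ltr_wpDr//.
  by apply: sumr_ge0 => i _; exact: pi_ge0.
have := pi_mass_Cauchy_Schwarz (killed_heat n) pi_ge0 pi_gt0.
by have := pi_mass_heat n; nra.
Qed.

End killed_walk.

(** * Valleys of the potential *)

Section climbs.
Context {R : realType}.
Implicit Types (x : nat -> R) (h d : R).

Definition climbs x h d (m : nat) : Prop :=
  h <= \sum_(j < m) x j /\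
  forall k, (k <= m)%N -> - d <= \sum_(j < k) x j.

Lemma climbs_gt0 x h d m : 0 < h -> climbs x h d m -> (0 < m)%N.
Proof. by case: m => // h0 []; rewrite big_ord0 leNgt h0. Qed.

(* [x true] and [x false] list the increments of the potential met when leaving
   the origin to the right and to the left. *)
Definition valley (x : bool -> nat -> R) (delta h : R) : Prop :=
  exists2 n : nat, n.*2.+1%:R <= expR (delta * h) &
    forall s, exists2 m, (m <= n)%N & climbs (x s) h (delta * h) m.

End climbs.

Section environment_potential.
Context {R : realType}.
Implicit Type w : int -> R.

(* The walk reflected at the origin sees the environment [oriented false w]. *)
Definition oriented (s : bool) w (x : int) : R :=
  if s then w x else 1 - w (- x).

Definition log_ratio w (j : nat) : R := ln (rho (w j.+1)).

Definition half_reversible w (m : nat) : R :=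
  \prod_(j < m) (w j / (1 - w j.+1)).

Definition reversible w (x : int) : R :=
  match x with
  | Posz m => half_reversible w m
  | Negz m => half_reversible (oriented false w) m.+1
  end.

Lemma reversible_opp w (m : nat) :
  reversible w (- m%:Z) = half_reversible (oriented false w) m.
Proof.
by case: m => [|m]; rewrite -?NegzE// oppr0 /= /half_reversible !big_ord0.
Qed.

Variable eps : R.
Hypothesis eps_gt0 : 0 < eps.

Definition elliptic w : Prop := forall x, eps <= w x <= 1 - eps.

Lemma elliptic_oriented s w : elliptic w -> elliptic (oriented s w).
Proof. by case: s => // ellw x; have := ellw (- x); rewrite /oriented; lra. Qed.

Lemma elliptic_gt0 w x : elliptic w -> 0 < w x.
Proof. by move=> ellw; have := ellw x; have := eps_gt0; lra. Qed.

Lemma elliptic_lt1 w x : elliptic w -> 0 < 1 - w x.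
Proof. by move=> ellw; have := ellw x; have := eps_gt0; lra. Qed.

Lemma half_reversible_gt0 w m : elliptic w -> 0 < half_reversible w m.
Proof.
move=> ellw; apply: prodr_gt0 => j _.
by rewrite divr_gt0 ?elliptic_gt0 ?elliptic_lt1.
Qed.

Lemma reversible_gt0 w x : elliptic w -> 0 < reversible w x.
Proof.
move=> ellw; case: x => m; first exact: half_reversible_gt0.
exact/half_reversible_gt0/elliptic_oriented.
Qed.

Lemma half_reversibleS w m : elliptic w ->
  half_reversible w m.+1 * (1 - w m.+1) = half_reversible w m * w m.
Proof.
move=> ellw; rewrite /half_reversible big_ord_recr /=.
by rewrite -mulrA divfK// gt_eqF ?elliptic_lt1.
Qed.

Lemma reversible_balance w x : elliptic w ->
  reversible w x * w x = reversible w (x + 1) * (1 - w (x + 1)).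
Proof.
move=> ellw; case: x => m.
  have -> : m%:Z + 1 = m.+1 by rewrite -addn1 PoszD.
  by rewrite /= half_reversibleS.
have -> : Negz m + 1 = - m%:Z by rewrite NegzE; lia.
have := half_reversibleS m (elliptic_oriented false ellw).
by rewrite reversible_opp /= subKr -NegzE.
Qed.

Lemma half_reversibleE w m : elliptic w ->
  half_reversible w m * w m = w 0 * expR (- \sum_(j < m) log_ratio w j).
Proof.
move=> ellw; elim: m => [|m IH].
  by rewrite /half_reversible !big_ord0 oppr0 expR0 mulrC.
have [w0 w1] := (elliptic_gt0 m.+1 ellw, elliptic_lt1 m.+1 ellw).
rewrite big_ord_recr /= opprD expRD mulrA -IH -(half_reversibleS m ellw).
rewrite /log_ratio expRN lnK ?posrE /rho ?divr_gt0//.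
by field; rewrite !gt_eqF.
Qed.

Lemma half_reversible_le w m : elliptic w ->
  half_reversible w m <= eps^-1 * expR (- \sum_(j < m) log_ratio w j).
Proof.
move=> ellw; rewrite ler_pdivlMl//; have := half_reversibleE m ellw.
have := half_reversible_gt0 m ellw; have := ellw 0; have := ellw m.
have := expR_gt0 (- \sum_(j < m) log_ratio w j); have := eps_gt0; nra.
Qed.

Lemma half_reversible_path_le w h l m k : elliptic w ->
  climbs (log_ratio w) h l m -> (k <= m)%N ->
  half_reversible w k <= eps^-1 * expR l.
Proof.
move=> ellw [_ path_ge] km; apply: le_trans (half_reversible_le k ellw) _.
by rewrite ler_pM2l ?invr_gt0// ler_expR lerNl path_ge.
Qed.

Lemma half_reversible_top_le w h l m : elliptic w ->
  climbs (log_ratio w) h l m -> half_reversible w m <= eps^-1 * expR (- h).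
Proof.
move=> ellw [top_ge _]; apply: le_trans (half_reversible_le m ellw) _.
by rewrite ler_pM2l ?invr_gt0// ler_expR lerN2.
Qed.

End environment_potential.

Section conditional_probability.
Context {d : measure_display} {T : measurableType d} {R : realType}.
Variable Q : probability T R.

Lemma cond_probM (A B : set T) : measurable A -> measurable B ->
  cond_prob Q A B * fine (Q B) = fine (Q (A `&` B)).
Proof.
move=> mA mB; rewrite /cond_prob; have [QB0|QB0] := eqVneq (fine (Q B)) 0.
  rewrite QB0 mulr0; apply/esym/eqP; rewrite eq_le fine_ge0// andbT -QB0.
  apply: fine_le; rewrite ?fin_num_measure//; first exact: measurableI.
  by apply: le_measure; rewrite ?inE//; exact: measurableI.
by rewrite divfK.
Qed.

End conditional_probability.

Section quenched_return_probability.
Context {R : realType} {d : measure_display} {T : measurableType d}.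
Variables (Q : probability T R) (w : int -> R) (X : nat -> T -> int).
Hypothesis walkX : walk_in_environment Q w 0 X.

Lemma walk_measurable n y : measurable [set t | X n t = y].
Proof. by have [mX _ _ _] := walkX; exact: (mX n [set y]). Qed.

Let prob n y := fine (Q [set t | X n t = y]).

Lemma walk_transition n (y : int) :
  w y * prob n y =
    fine (Q ([set t | X n.+1 t = y + 1] `&` [set t | X n t = y])) /\
  (1 - w y) * prob n y =
    fine (Q ([set t | X n.+1 t = y - 1] `&` [set t | X n t = y])).
Proof.
have mX := walk_measurable; have [_ _ _ trX] := walkX.
rewrite -!cond_probM// /prob.
have [->|Q0] := eqVneq (Q [set t | X n t = y]) 0%E; first by rewrite !mulr0.
have /trX[-> ->] : (0 < Q [set t | X n t = y])%E by rewrite lt0e Q0 measure_ge0.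
by rewrite subKr.
Qed.

Lemma walk_step_le n (y : int) :
  w (y - 1) * prob n (y - 1) + (1 - w (y + 1)) * prob n (y + 1) <= prob n.+1 y.
Proof.
have mX := walk_measurable.
have [-> _] := walk_transition n (y - 1).
have [_ ->] := walk_transition n (y + 1).
rewrite subrK addrK -fineD ?fin_num_measure//; [|exact: measurableI..].
rewrite -measureU//; [|exact: measurableI..|]; last first.
  by apply/seteqP; split => t //= [[_ ->] [_]]; lia.
have mU : measurable (([set t | X n.+1 t = y] `&` [set t | X n t = y - 1]) `|`
    ([set t | X n.+1 t = y] `&` [set t | X n t = y + 1])).
  by apply: measurableU; exact: measurableI.
apply: fine_le; rewrite ?fin_num_measure//.
by apply: le_measure; rewrite ?inE// => t [[]|[]].
Qed.

Variable eps : R.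
Hypotheses (eps_gt0 : 0 < eps) (ellw : elliptic eps w).

Section interval.
Variables a b : nat.
Hypotheses (a_gt0 : (0 < a)%N) (b_gt0 : (0 < b)%N).

Let site (i : nat) : int := i%:Z - a%:Z.
Let p i := w (site i).
Let pi i := reversible w (site i).
Let heat := killed_heat p (a + b) a.

Let siteS i : site i.+1 = site i + 1.
Proof. by rewrite /site; lia. Qed.

Let p01 i : 0 <= p i <= 1.
Proof. by have := ellw (site i); rewrite /p; have := eps_gt0; lra. Qed.

Let pi_ge0 i : 0 <= pi i.
Proof. exact/ltW/(reversible_gt0 eps_gt0 _ ellw). Qed.

Let balance i : pi i * p i = pi i.+1 * (1 - p i.+1).
Proof. by rewrite /pi /p siteS; exact: reversible_balance ellw. Qed.

Let pi_right i : (a <= i)%N -> pi i = half_reversible w (i - a).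
Proof. by move=> ai; rewrite /pi /site subzn. Qed.

Let pi_left i : (i <= a)%N ->
  pi i = half_reversible (oriented false w) (a - i).
Proof. by move=> ia; rewrite /pi /site -opprB subzn// reversible_opp. Qed.

Let pi_origin : pi a = 1.
Proof. by rewrite pi_right// subnn /half_reversible big_ord0. Qed.

Lemma walk_ge_killed_heat n i : pi i * heat n i <= prob n (site i).
Proof.
elim: n i => [|n IH] i.
  rewrite /heat /=; case: eqP => [->|_]; last by rewrite mulr0 fine_ge0.
  have [_ X0 _ _] := walkX.
  by rewrite mulr1 pi_origin /prob /site subrr X0.
rewrite /heat /= /killed_step; case: ifP => [|_]; last first.
  by rewrite mulr0 fine_ge0.
case: i => // i _; rewrite /walk_step -/(heat n) [i.+1.-1]/=.
have -> : pi i.+1 * (p i.+1 * heat n i.+2 + (1 - p i.+1) * heat n i) =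
    p i * (pi i * heat n i) + (1 - p i.+2) * (pi i.+2 * heat n i.+2).
  by rewrite mulrDr !mulrA (balance i.+1) -(balance i); ring.
apply: le_trans (walk_step_le n (site i.+1)).
have -> : site i.+1 - 1 = site i by rewrite siteS addrK.
have [/andP[p0 _] /andP[_ p1]] := (p01 i, p01 i.+2).
by rewrite -siteS lerD// ler_wpM2l// subr_ge0.
Qed.

Variables h l : R.
Hypotheses (climb_right : climbs (log_ratio w) h l b)
  (climb_left : climbs (log_ratio (oriented false w)) h l a).

Let pi_le i : (i <= a + b)%N -> pi i <= eps^-1 * expR l.
Proof.
move=> iab; have [ai|/ltnW ia] := leqP a i.
- rewrite pi_right//; apply: (half_reversible_path_le eps_gt0 ellw climb_right).
  by lia.
- rewrite pi_left//; apply: (half_reversible_path_le eps_gt0 _ climb_left).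
    exact: elliptic_oriented.
  by lia.
Qed.

Let pi_ends : pi 0%N + pi (a + b)%N <= 2 * (eps^-1 * expR (- h)).
Proof.
rewrite mulr_natl mulr2n pi_left// pi_right ?leq_addr// subn0 addKn.
apply: lerD; last exact: (half_reversible_top_le eps_gt0 ellw climb_right).
apply: (half_reversible_top_le eps_gt0 _ climb_left).
exact: elliptic_oriented.
Qed.

Lemma return_probability_interval n : n%:R <= eps / 4 * expR h ->
  1 <= 4 * ((a + b).+1%:R * (eps^-1 * expR l)) * prob (2 * n) 0.
Proof.
move=> nle; have a_inside : (0 < a < a + b)%N by lia.
have ends_le : n%:R * (pi 0%N + pi (a + b)%N) <= 1 / 2.
  have -> : 1 / 2 = eps / 4 * expR h * (2 * (eps^-1 * expR (- h))).
    by rewrite expRN; field; rewrite !gt_eqF ?expR_gt0.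
  by apply: (ler_pM _ _ nle pi_ends); [exact: ler0n|exact: addr_ge0].
have diag := killed_heat_diag_ge p01 pi_ge0 balance a_inside pi_origin ends_le.
have heat_le : heat (n + n) a <= prob (2 * n) 0.
  have := walk_ge_killed_heat (n + n) a.
  by rewrite pi_origin mul1r addnn -mul2n /site subrr.
have sum_le : \sum_(i < (a + b).+1) pi i <= (a + b).+1%:R * (eps^-1 * expR l).
  rewrite mulr_natl -[X in _ *+ X]card_ord -sumr_const.
  by apply: ler_sum => i _; apply: pi_le; rewrite -ltnS.
apply: (le_trans diag); apply: ler_pM => //; last by rewrite ler_wpM2l.
- by rewrite mulr_ge0// sumr_ge0.
- by have /andP[] := killed_heat01 (a + b) p01 a (n + n) a.
Qed.

End interval.

Lemma return_probability_valley (delta h : R) n : 0 < h ->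
  valley (fun s => log_ratio (oriented s w)) delta h ->
  n%:R <= eps / 4 * expR h ->
  eps / 4 * expR (- (2 * delta * h)) <= prob (2 * n) 0.
Proof.
move=> h0 [m width sides] nle.
have [b bm right] := sides true; have [a am left] := sides false.
have [a0 b0] := (climbs_gt0 h0 left, climbs_gt0 h0 right).
have := return_probability_interval a0 b0 right left nle.
set e := expR _ in width *; set c := (a + b).+1%:R => return_ge.
have e0 : 0 < e by exact: expR_gt0.
have ce : c <= e by apply: le_trans width; rewrite ler_nat; lia.
have prob_ge0 : 0 <= prob (2 * n) 0 by rewrite fine_ge0.
have -> : expR (- (2 * delta * h)) = (e * e)^-1.
  by rewrite expRN -expRD; congr (expR _)^-1; ring.
rewrite ler_pdivrMr ?mulr_gt0//.
have eps_le : eps <= 4 * (c * e) * prob (2 * n) 0.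
  rewrite -(ler_pM2l (x := eps^-1)) ?invr_gt0// mulVf ?gt_eqF//.
  rewrite (_ : eps^-1 * _ = 4 * (c * (eps^-1 * e)) * prob (2 * n) 0)//.
  by ring.
have : c * e * prob (2 * n) 0 <= e * e * prob (2 * n) 0.
  by rewrite ler_wpM2r// ler_wpM2r// ltW.
by lra.
Qed.

Lemma valleys_return_series_eqy (alpha : R) : 0 <= alpha < 1 ->
  (forall h0, exists2 h, h0 <= h &
    valley (fun s => log_ratio (oriented s w)) ((1 - alpha) / 4) h) ->
  (\sum_(1 <= n <oo)
     (Q [set t | X (2 * n)%N t = 0%R] * (n%:R `^ (- alpha))%:E) = +oo)%E.
Proof.
move=> /andP[alpha0 alpha1] valleys.
have eps4 : 0 < eps / 4 by rewrite divr_gt0.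
apply: (nneseries_powR_eqy (b := 2 * ((1 - alpha) / 4)) alpha0 _ eps4) => //.
  by lra.
move=> x0; have [h] := valleys (Num.max 1 (ln (Num.max 1 x0))).
rewrite ge_max => /andP[h1 hx0] valley_h.
have h0 : 0 < h by exact: lt_le_trans h1.
exists (expR h) => [|n _ nle].
  apply: (@le_trans _ _ (Num.max 1 x0)); first by rewrite le_max lexx orbT.
  by rewrite -[leLHS]lnK ?ler_expR// posrE lt_max ltr01.
rewrite -[Q _]fineK ?fin_num_measure ?lee_fin//; last exact: walk_measurable.
rewrite -expRM mulrN [h * _]mulrC.
exact: return_probability_valley h0 valley_h nle.
Qed.

End quenched_return_probability.

(** * Infinitely many valleys *)

Section stopped_sum_paths.
Context {R : realType}.
Implicit Type x : nat -> R.

Lemma climbs_weaken x h h' l l' m : h' <= h -> l <= l' ->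
  climbs x h l m -> climbs x h' l' m.
Proof.
move=> h'h ll' [xh xl]; split=> [|k /xl]; first exact: le_trans xh.
by apply: le_trans; rewrite lerN2.
Qed.

Lemma stopped_sum_partial_sum (J : interval R) x n : exists2 m, (m <= n)%N &
  [/\ stopped_sum J x n = \sum_(j < m) x j,
      forall i, (i < m)%N -> \sum_(j < i) x j \in J &
      m = n \/ \sum_(j < m) x j \notin J].
Proof.
elim: n => [|n [m mn [sm in_J stop]]] /=.
  by exists 0%N => //; split; [rewrite big_ord0| |left].
rewrite sm; case: ifPn => [ins|outs]; last first.
  by exists m; [exact: leqW|split; [rewrite addr0| |right]].
case: stop => [mE|]; last by rewrite ins.
exists n.+1 => //; split; [by rewrite -mE big_ord_recr| |by left].
by move=> i; rewrite -mE ltnS leq_eqVlt => /orP[/eqP ->|/in_J].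
Qed.

Lemma stopped_sum_climbs x (B D C : R) n0 n : 0 <= B -> 0 <= D ->
  (forall j, `|x j| <= C) ->
  B <= stopped_sum `]- D, B[ (fun j => x (n0 + j)%N) n ->
  exists2 m, (m <= n0 + n)%N & climbs x (B - n0%:R * C) (D + n0%:R * C) m.
Proof.
move=> B0 D0 xC.
have [m mn [-> in_J _]] :=
  stopped_sum_partial_sum `]- D, B[ (fun j => x (n0 + j)%N) n.
move=> Bm; exists (n0 + m)%N; first by rewrite leq_add2l.
have C0 : 0 <= C := le_trans (normr_ge0 _) (xC 0%N).
have start_ge k : - (k%:R * C) <= \sum_(j < k) x j.
  elim: k => [|k IH]; first by rewrite big_ord0 mul0r oppr0.
  by rewrite big_ord_recr /= -natr1; have := xC k; rewrite ler_norml; lra.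
have start_le k : (k <= n0)%N -> k%:R * C <= n0%:R * C.
  by move=> kn; rewrite ler_wpM2r// ler_nat.
have sumD k : \sum_(j < n0 + k) x j =
    \sum_(j < n0) x j + \sum_(j < k) x (n0 + j)%N by rewrite big_split_ord.
split=> [|k k_le]; first by rewrite sumD; have := start_ge n0; lra.
have [kn|/ltnW nk] := leqP k n0.
  by have := start_ge k; have := start_le k kn; lra.
rewrite -(subnKC nk) sumD; have := start_ge n0.
have [->|km] := eqVneq (k - n0)%N m; first by lra.
have := in_J (k - n0)%N; rewrite ltn_neqAle km leq_subLR k_le in_itv /=.
by move=> /(_ isT) /andP[]; lra.
Qed.

End stopped_sum_paths.

Section independent_upcrossing.
Context {d : measure_display} {T : measurableType d} {R : realType}.
Variables (P : probability T R) (I : choiceType) (Y : I -> {RV P >-> R}).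
Variable phi : nat -> I.

Lemma depends_on_stopped_sum (J : interval R) n :
  depends_on Y (phi @` `I_n) (fun t => stopped_sum J (fun j => Y (phi j) t) n).
Proof.
elim: n => [|n IH] /=; first exact: measurable_cst.
have Dn : phi @` `I_n `<=` phi @` `I_n.+1.
  by apply: image_subset => k /= /leqW.
have := subset_depends_on Dn IH; rewrite /depends_on => mS.
have mY : depends_on Y (phi @` `I_n.+1) (Y (phi n)).
  have sub : [set phi n] `<=` phi @` `I_n.+1 by move=> _ ->; exists n => /=.
  exact: subset_depends_on sub (depends_on_coordinate Y (phi n)).
set S := fun t => stopped_sum J _ n in mS *.
have -> : (fun t => S t + (if S t \in J then Y (phi n) t else 0)) =
    fun t => S t + \1_[set` J] (S t) * Y (phi n) t.
  by apply/funext => t; rewrite indicE mem_setE; case: (S t \in J);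
    rewrite ?mul1r ?mul0r.
have m_alive : measurable_fun setT (\1_[set` J] : R -> R).
  by apply: measurable_indic; exact: measurable_itv.
exact: (measurable_funD mS (measurable_funM (measurableT_comp m_alive mS) mY)).
Qed.

Hypotheses (phi_inj : injective phi) (indepY : mutually_independent Y).

Lemma independent_stopped_sum (J : interval R) n :
  independent_RV P (fun t => stopped_sum J (fun j => Y (phi j) t) n)
    (Y (phi n)).
Proof.
have disj : phi @` `I_n `&` [set phi n] = set0.
  apply/seteqP; split => // _ [[j /= jn <-] /phi_inj jE].
  by rewrite jE ltnn in jn.
exact: (independent_RV_disjoint indepY disj (@depends_on_stopped_sum J n)
  (depends_on_coordinate Y (phi n))).
Qed.

Variables (C s2 delta : R).
Hypotheses (Y_le : forall i t, `|Y i t| <= C)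
  (mean_Y : forall i, \int[P]_t Y i t = 0)
  (var_Y : forall i, \int[P]_t (Y i t ^+ 2) = s2) (s2_gt0 : 0 < s2).
Hypothesis delta01 : 0 < delta <= 1.

(* Over [M ^ 3] steps, much more than the diffusive scale [M ^ 2], the walk is
   unlikely to stay between the two barriers. *)
Lemma probability_upcrossing_ge (M : nat) : C <= M%:R ->
  192 <= delta * s2 * M%:R ->
  delta / 16 <= fine (P [set t | 2 * M%:R <=
    stopped_sum `]- (delta * M%:R / 2), 2 * M%:R[ (fun j => Y (phi j) t)
      (M ^ 3)]).
Proof.
move=> C_le M_large; have /andP[d0 d1] := delta01.
have M_gt0 : 0 < M%:R :> R.
  have ds2 : 0 < delta * s2 by exact: mulr_gt0.
  by rewrite -(pmulr_rgt0 _ ds2); apply: lt_le_trans M_large; rewrite ltr0n.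
set B := 2 * M%:R; set D := delta * M%:R / 2; set p := fine _.
have B0 : 0 <= B by rewrite mulr_ge0.
have D0 : 0 < D by rewrite divr_gt0// mulr_gt0.
have D_le : D <= M%:R / 2 by rewrite /D ler_wpM2r// ler_piMl// ltW.
have C0 : 0 <= C by exact: le_trans (normr_ge0 _) (Y_le (phi 0%N) point).
have many_steps : (B + D) * (B + D + C) ^+ 2 <= D / 2 * ((M ^ 3)%:R * s2).
  apply: (@le_trans _ _ (3 * M%:R * (4 * M%:R) ^+ 2)).
    have BE : B = 2 * M%:R by [].
    apply: ler_pM; rewrite ?sqr_ge0 ?lerXn2r ?nnegrE//; lra.
  have -> : D / 2 * ((M ^ 3)%:R * s2) = M%:R ^+ 3 / 4 * (delta * s2 * M%:R).
    by rewrite natrX /D; field.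
  have -> : 3 * M%:R * (4 * M%:R) ^+ 2 = M%:R ^+ 3 / 4 * 192 :> R by field.
  by rewrite ler_wpM2l// divr_ge0// exprn_ge0.
have : D / 2 <= (B + D + C) * p.
  apply: (stopped_sum_upcrossing B0 D0 _ _ _ _ _ s2_gt0 many_steps) => //.
  exact: independent_stopped_sum.
have p0 : 0 <= p by rewrite fine_ge0.
have p_le : (B + D + C) * p <= 4 * M%:R * p by rewrite ler_wpM2r// /B; lra.
move=> /le_trans/(_ p_le); have -> : D / 2 = 4 * M%:R * (delta / 16).
  by rewrite /D; field.
by rewrite ler_pM2l// mulr_gt0.
Qed.

End independent_upcrossing.

(* [block_start] is negligible compared with [block_height], so that the
   potential accumulated before a block is a small fraction of the depth of its
   valley. *)
Fixpoint block_start (k : nat) : nat :=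
  if k is j.+1 then (block_start j + (block_start j + k) ^ 6)%N else 0%N.

Arguments block_start : simpl never.

Definition block_height (k : nat) : nat := ((block_start k + k.+1) ^ 2)%N.

Lemma block_startS k :
  block_start k.+1 = (block_start k + block_height k ^ 3)%N.
Proof. by rewrite /block_height -expnM. Qed.

Lemma block_start_homo : {homo block_start : k l / (k <= l)%N}.
Proof.
apply: homo_leq => // [k l m|k]; first exact: leq_trans.
by rewrite block_startS leq_addr.
Qed.

Lemma leq_block_height k : (block_start k + k.+1 <= block_height k)%N.
Proof. by rewrite -[leqLHS]expn1 leq_pexp2l// addnS. Qed.

Lemma ltn_block_height k : (k < block_height k)%N.
Proof. exact: leq_trans (leq_addl _ _) (leq_block_height k). Qed.

Lemma block_width_le k :
  ((block_start k.+1).*2.+1 <= 5 * block_height k ^ 3)%N.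
Proof.
have h_gt0 : (0 < block_height k)%N.
  exact: leq_ltn_trans (ltn_block_height k).
have h_cube : (block_height k <= block_height k ^ 3)%N.
  by rewrite -[leqLHS]expn1 leq_pexp2l.
have start_le : (block_start k <= block_height k)%N.
  exact: leq_trans (leq_addr _ _) (leq_block_height k).
by rewrite block_startS; lia.
Qed.

Lemma cube_le_expR {R : realType} (a h : R) : 0 <= h -> 0 <= a ->
  120 <= a ^+ 4 * h -> 5 * h ^+ 3 <= expR (a * h).
Proof.
move=> h0 a0 large; apply: le_trans (expR_ge1Dxn 3 (mulr_ge0 a0 h0)).
have -> : 1 + (a * h) ^+ 4 / 4`!%:R = 1 + h ^+ 3 / 24 * (a ^+ 4 * h).
  by rewrite (_ : 4`! = 24)%N//; field.
have -> : 5 * h ^+ 3 = h ^+ 3 / 24 * 120 by field.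
by rewrite ler_wpDl// ler_wpM2l// divr_ge0// exprn_ge0.
Qed.

Section random_valleys.
Context {d : measure_display} {T : measurableType d} {R : realType}.
Variables (P : probability T R) (xi : bool * nat -> {RV P >-> R}).
Hypothesis indep_xi : mutually_independent xi.
Variables (C s2 delta : R).
Hypotheses (xi_le : forall i t, `|xi i t| <= C)
  (mean_xi : forall i, \int[P]_t xi i t = 0)
  (var_xi : forall i, \int[P]_t (xi i t ^+ 2) = s2) (s2_gt0 : 0 < s2).
Hypothesis delta01 : 0 < delta <= 1.

Let height k : R := (block_height k)%:R.

Let height_ge k : k%:R <= height k.
Proof. by rewrite ler_nat ltnW// ltn_block_height. Qed.

Let block_site s k j : bool * nat := (s, (block_start k + j)%N).

Let block_site_inj s k : injective (block_site s k).
Proof. by move=> i j [/addnI]. Qed.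

Definition block_sum (s : bool) (k : nat) (t : T) : R :=
  stopped_sum `]- (delta * height k / 2), 2 * height k[
    (fun j => xi (block_site s k j) t) (block_height k ^ 3).

Definition block_climb (s : bool) (k : nat) : set T :=
  [set t | 2 * height k <= block_sum s k t].

Definition block_valley (k : nat) : set T :=
  block_climb true k `&` block_climb false k.

Lemma block_climb_sigma s k :
  <<s cylinders xi (block_site s k @` `I_(block_height k ^ 3)) >>
    (block_climb s k).
Proof.
rewrite /block_climb -preimage_itvcy.
apply: depends_on_preimage; last exact: measurable_itv.
exact: depends_on_stopped_sum.
Qed.

Lemma block_valley_sigma k :
  <<s cylinders xi [set i | (block_start k <= i.2 < block_start k.+1)%N] >>
    (block_valley k).
Proof.
set D := [set i | _].
have climb_sigma s : <<s cylinders xi D >> (block_climb s k).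
  apply: subset_sigma_cylinders (@block_climb_sigma s k) => _ [j /= jh <-].
  by rewrite /D /block_site /= block_startS leq_addr ltn_add2l.
exact: (@measurableI _ (g_sigma_algebraType _) _ _
  (climb_sigma true) (climb_sigma false)).
Qed.

Lemma block_climb_measurable s k : measurable (block_climb s k).
Proof. exact: sigma_cylinders_measurable (@block_climb_sigma s k). Qed.

Lemma block_valley_measurable k : measurable (block_valley k).
Proof. by apply: measurableI; exact: block_climb_measurable. Qed.

Lemma independent_block_valleys : independent_events P block_valley.
Proof.
apply: (independent_events_disjoint indep_xi _ block_valley_sigma).
move=> k l _ _ [[s j] [/= /andP[kj jk] /andP[lj jl]]].
have ordered i m : (block_start i <= j)%N -> (j < block_start m.+1)%N ->
    (i <= m)%N.
  move=> ij jm; rewrite leqNgt; apply/negP => /block_start_homo.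
  by rewrite leqNgt (leq_ltn_trans ij jm).
by apply/anti_leq/andP; split; exact: ordered.
Qed.

Lemma probability_block_valley_ge :
  \forall k \near \oo, (((delta / 16) ^+ 2)%:E <= P (block_valley k))%E.
Proof.
have /andP[d0 _] := delta01.
near=> k.
have climb s : delta / 16 <= fine (P (block_climb s k)).
  apply: (probability_upcrossing_ge (@block_site_inj s k) indep_xi xi_le mean_xi
    var_xi s2_gt0 delta01).
  - by apply: le_trans (height_ge k); near: k; exact: nbhs_infty_ger.
  - rewrite -ler_pdivrMl ?mulr_gt0//; apply: le_trans (height_ge k).
    by near: k; exact: nbhs_infty_ger.
have disj : block_site true k @` `I_(block_height k ^ 3) `&`
    block_site false k @` `I_(block_height k ^ 3) = set0.
  by apply/seteqP; split => // _ [[i _ <-] [j _ []]].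
have -> : P (block_valley k) =
    (P (block_climb true k) * P (block_climb false k))%E.
  exact: (independent_sigma_cylinders indep_xi disj) (@block_climb_sigma _ k)
    (@block_climb_sigma _ k).
have mP s : P (block_climb s k) \is a fin_num.
  exact/fin_num_measure/block_climb_measurable.
rewrite -(fineK (mP true)) -(fineK (mP false)) -EFinM lee_fin expr2.
by apply: ler_pM => //; rewrite divr_ge0// ltW.
Unshelve. all: by end_near. Qed.

Lemma block_valley_subset : \forall k \near \oo, block_valley k `<=`
  [set t | valley (fun s j => xi (s, j) t) delta (height k)].
Proof.
have /andP[d0 d1] := delta01.
near=> k.
have C0 : 0 <= C := le_trans (normr_ge0 _) (xi_le (true, 0%N) point).
pose n := (block_start k + k.+1)%N.
have k_le_n : k%:R <= n%:R :> R by rewrite ler_nat /n addnS leqW// leq_addl.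
have heightE : height k = n%:R ^+ 2 by rewrite /height natrX.
have start_le : (block_start k)%:R * C <= delta * height k / 2.
  apply: (@le_trans _ _ (n%:R * C)).
    by rewrite ler_wpM2r// ler_nat /n leq_addr.
  rewrite heightE; have : 2 * C / delta <= n%:R.
    by apply: le_trans k_le_n; near: k; exact: nbhs_infty_ger.
  by rewrite ler_pdivrMr//; have := ler0n R n; nra.
have width : (block_start k.+1).*2.+1%:R <= expR (delta * height k).
  apply: le_trans (_ : 5 * height k ^+ 3 <= _).
    by rewrite /height -natrX -natrM ler_nat; exact: block_width_le.
  apply: cube_le_expR; rewrite ?mulr_ge0// ?(ltW d0)//.
  rewrite -ler_pdivrMl ?exprn_gt0//; apply: le_trans (height_ge k).
  by near: k; exact: nbhs_infty_ger.
move=> t [up_right up_left]; exists (block_start k.+1) => // s.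
have up : 2 * height k <= block_sum s k t by case: s.
have h0 : 0 <= height k by [].
have dh0 : 0 <= delta * height k / 2 by rewrite divr_ge0// mulr_ge0// ltW.
have B0 : 0 <= 2 * height k by rewrite mulr_ge0.
have [m m_le climb] := stopped_sum_climbs B0 dh0 (fun j => xi_le (s, j) t) up.
exists m; first by rewrite block_startS.
apply: climbs_weaken climb; last by lra.
have : delta * height k <= height k by rewrite ler_piMl.
by lra.
Unshelve. all: by end_near. Qed.

Lemma ae_valleys : \forall t \ae P, forall h0, exists2 h, h0 <= h &
  valley (fun s j => xi (s, j) t) delta h.
Proof.
have /andP[d0 _] := delta01.
have often : \forall t \ae P, lim_sup_set block_valley t.
  apply: second_Borel_Cantelli.
  - exact: block_valley_measurable.
  - exact: independent_block_valleys.
  - apply: (nneseries_near_ge_eqy _ (_ : 0 < (delta / 16) ^+ 2)) => //.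
      by rewrite exprn_gt0// divr_gt0.
    exact: probability_block_valley_ge.
have [k0 _ sub] := block_valley_subset.
apply: filterS often => t often_t h0.
have [k /= k_ge valley_k] := often_t (maxn k0 (Num.trunc h0).+1) I.
move: k_ge; rewrite geq_max => /andP[/sub valley_h h0_lt].
exists (height k); last exact: valley_h.
apply: le_trans (height_ge k); apply/ltW/(lt_le_trans (truncnS_gt h0)).
by rewrite ler_nat.
Qed.

End random_valleys.

(** * The environment *)

Section clamped_log_ratio.
Context {R : realType}.
Implicit Type u : R.

Lemma ln_rho u : 0 < u < 1 -> ln (rho u) = ln (1 - u) - ln u.
Proof.
by move=> /andP[u0 u1]; rewrite /rho lnM ?posrE ?subr_gt0 ?invr_gt0// lnV.
Qed.

Lemma ln_rhoC u : 0 < u < 1 -> ln (rho (1 - u)) = - ln (rho u).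
Proof. by move=> u01; rewrite !ln_rho// ?subKr ?opprB//; lra. Qed.

Variable eps : R.
Hypotheses (eps_gt0 : 0 < eps) (eps_lt : eps < 1 / 2).

(* Ellipticity only holds almost surely: clamping makes the log-ratio bounded
   everywhere. *)
Definition clamp u : R := Num.max eps (Num.min u (1 - eps)).

Definition clamped_log_ratio u : R := ln (rho (clamp u)).

Lemma clamp_itv u : eps <= clamp u <= 1 - eps.
Proof.
have [e0 e1] := (eps_gt0, eps_lt).
by rewrite /clamp le_max lexx /= ge_max ge_min lexx orbT andbT; lra.
Qed.

Lemma clamp_id u : eps <= u <= 1 - eps -> clamp u = u.
Proof. by move=> /andP[eu ue]; rewrite /clamp min_l// max_r. Qed.

Lemma clamped_log_ratioE u :
  clamped_log_ratio u = ln (1 - clamp u) - ln (clamp u).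
Proof.
by apply: ln_rho; have := clamp_itv u; have [e0 e1] := (eps_gt0, eps_lt); lra.
Qed.

Lemma measurable_clamped_log_ratio : measurable_fun setT clamped_log_ratio.
Proof.
have m_clamp : measurable_fun setT clamp.
  by apply: measurable_maxr => //; exact: measurable_minr.
rewrite (funext clamped_log_ratioE); apply: measurable_funB;
  apply: measurableT_comp => //; try exact: measurable_ln.
exact: measurable_funB.
Qed.

Lemma clamped_log_ratio_le u : `|clamped_log_ratio u| <= - ln eps.
Proof.
have [/andP[cl cu] [e0 e1]] := (clamp_itv u, (eps_gt0, eps_lt)).
have ln_itv v : eps <= v -> v <= 1 -> ln eps <= ln v <= 0.
  by move=> ev v1; rewrite ler_ln ?posrE ?ev ?ln_le0//; exact: lt_le_trans ev.
have ln_clamp : ln eps <= ln (clamp u) <= 0 by apply: ln_itv; lra.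
have ln_clampC : ln eps <= ln (1 - clamp u) <= 0 by apply: ln_itv; lra.
by rewrite clamped_log_ratioE ler_norml; lra.
Qed.

End clamped_log_ratio.

Section random_environment_valleys.
Context {d : measure_display} {T : measurableType d} {R : realType}.
Variables (P : probability T R) (omega : int -> {RV P >-> R}).
Hypotheses (iid_omega : iid omega) (omega01 : forall x t, 0 < omega x t < 1).
Variable eps : R.
Hypotheses (eps_gt0 : 0 < eps) (eps_lt : eps < 1 / 2).
Hypothesis elliptic0 : P [set t | eps <= omega 0 t <= 1 - eps] = 1%E.

Lemma ae_elliptic : \forall t \ae P, elliptic eps (fun x => omega x t).
Proof.
pose I := `[eps, 1 - eps]%classic.
have mI : measurable I by exact: measurable_itv.
have PI : P (omega 0 @^-1` I) = 1%E by exact: elliptic0.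
apply: filterS (identically_distributed_ae iid_omega.2 mI PI) => t It x.
by have := It x; rewrite /I /= in_itv.
Qed.

Let g := clamped_log_ratio eps.

Let g_bounded : bounded_measurable g.
Proof.
split; first exact: measurable_clamped_log_ratio.
by exists (- ln eps); exact: clamped_log_ratio_le.
Qed.

Let g_log_ratio :
  \forall t \ae P, forall x, g (omega x t) = ln (rho (omega x t)).
Proof.
apply: filterS ae_elliptic => t ell x.
by rewrite /g /clamped_log_ratio clamp_id.
Qed.

Let g_omega_bounded x : bounded_measurable (fun t => g (omega x t)).
Proof. exact: (bounded_measurable_comp g_bounded). Qed.

Let ln_rho_measurable : measurable_fun setT (fun t => ln (rho (omega 0 t))).
Proof.
rewrite (_ : (fun t => _) = fun t => ln (1 - omega 0 t) - ln (omega 0 t)).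
  apply: measurable_funB; apply: measurableT_comp => //;
    try exact: measurable_ln.
  exact: measurable_funB.
by apply/funext => t; rewrite ln_rho.
Qed.

Hypothesis mean0 : 'E_P[fun t => ln (rho (omega 0 t))]%E = 0%E.
Hypothesis var_gt0 : (0 < 'V_P[fun t => ln (rho (omega 0 t))])%E.

Lemma clamped_mean : \int[P]_t g (omega 0 t) = 0.
Proof.
rewrite /Rintegral -[RHS]/(fine 0%E) -mean0 unlock; congr fine.
apply: ae_eq_integral => //.
- by apply/measurable_EFinP; case: (g_omega_bounded 0).
- exact/measurable_EFinP/ln_rho_measurable.
- by apply: filterS g_log_ratio => t /= gE _; rewrite gE.
Qed.

Lemma clamped_second_moment_gt0 : 0 < \int[P]_t (g (omega 0 t) ^+ 2).
Proof.
have g2 : bounded_measurable (fun t => g (omega 0 t) ^+ 2).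
  exact: bounded_measurableM (g_omega_bounded 0) (g_omega_bounded 0).
apply: fine_gt0; apply/andP; split; last first.
  rewrite ltey_eq (integrable_fin_num _ (bounded_measurable_integrable P g2))//.
move: var_gt0; rewrite /variance unlock mean0 unlock.
rewrite (_ : integral _ _ _ = \int[P]_t (g (omega 0 t) ^+ 2)%:E)%E//.
apply: ae_eq_integral => //.
- by apply/measurable_EFinP; apply: measurable_funM; exact: measurable_funB.
- by apply/measurable_EFinP; case: g2.
- have sqr (x : R) : (x - fine 0%E) * (x - fine 0%E) = x ^+ 2.
    by rewrite subr0 expr2.
  by apply: filterS g_log_ratio => t gE _; rewrite gE; congr EFin; exact: sqr.
Qed.

Let site (i : bool * nat) : int := if i.1 then i.2.+1%:Z else - i.2.+1%:Z.

Let signed_g (i : bool * nat) (u : R) : R := (-1) ^+ (~~ i.1) * g u.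

Let signed_g_bounded i : bounded_measurable (signed_g i).
Proof.
exact: bounded_measurableM (bounded_measurable_cst _) g_bounded.
Qed.

Let increment_measurable i :
  measurable_fun setT (fun t => signed_g i (omega (site i) t)).
Proof. by have [mg _] := signed_g_bounded i; exact: measurableT_comp. Qed.

Let increment (i : bool * nat) : {RV P >-> R} :=
  mfun_Sub (mem_set (increment_measurable i)).

Lemma ae_environment_valleys (delta : R) : 0 < delta <= 1 ->
  \forall t \ae P, forall h0, exists2 h, h0 <= h &
    valley (fun s => log_ratio (oriented s (fun x => omega x t))) delta h.
Proof.
move=> delta01.
have indep : mutually_independent increment.
  have site_inj : injective site.
    by move=> [[] i] [[] j]; rewrite /site /= => ij; congr pair; lia.
  have signed_g_measurable i : measurable_fun setT (signed_g i).
    by case: (signed_g_bounded i).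
  exact: (mutually_independent_comp site_inj signed_g_measurable) iid_omega.1.
have incr_le i t : `|increment i t| <= - ln eps.
  by rewrite /= normrMsign; exact: clamped_log_ratio_le.
have law (f : R -> R) (x : int) : bounded_measurable f ->
    \int[P]_t f (omega x t) = \int[P]_t f (omega 0 t).
  move=> bf; apply: identically_distributed_Rintegral iid_omega.2 bf.1 _ => y.
  exact/bounded_measurable_integrable/bounded_measurable_comp.
have mean_incr i : \int[P]_t increment i t = 0.
  rewrite RintegralZl//; last exact: bounded_measurable_integrable.
  by rewrite law// clamped_mean mulr0.
have var_incr i :
    \int[P]_t (increment i t ^+ 2) = \int[P]_t (g (omega 0 t) ^+ 2).
  rewrite -(law (fun u => g u ^+ 2) (site i)); last first.
    exact: bounded_measurableM.
  by apply: eq_Rintegral => t _; rewrite /= exprMn sqrr_sign mul1r.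
have valleys := ae_valleys indep incr_le mean_incr var_incr
  clamped_second_moment_gt0 delta01.
apply: filterS2 g_log_ratio valleys => t gE valleys_t h0.
have [h h_ge valley_h] := valleys_t h0; exists h => //.
rewrite (_ : (fun s => _) = fun s j => increment (s, j) t)//.
apply/funext => s; apply/funext => j.
rewrite /= /signed_g /site /log_ratio /oriented gE /=; case: s => /=.
  by rewrite mul1r.
by rewrite ln_rhoC// mulN1r.
Qed.

End random_environment_valleys.

Theorem theorem4p1 (R : realType) (d : measure_display) (T : measurableType d)
    (P : probability T R) (omega : int -> {RV P >-> R})
    (env_omega : random_environment omega)
    (mean0 : 'E_P[fun t => ln (rho (omega 0%R t))]%E = 0%E)
    (elliptic : exists eps : R, 0 < eps < 1 / 2 /\
       P [set t | eps <= omega 0 t <= 1 - eps] = 1%E)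
    (var_gt0 : (0 < 'V_P[fun t => ln (rho (omega 0%R t))])%E)
    (alpha : R) (alpha01 : 0 <= alpha < 1) :
  \forall t \ae P,
    forall (d' : measure_display) (T' : measurableType d')
      (Q : probability T' R) (X : nat -> T' -> int),
    walk_in_environment Q (fun x => omega x t) 0 X ->
    (\sum_(1 <= n <oo)
       (Q [set s | X (2 * n)%N s = 0%R] * (n%:R `^ (- alpha))%R%:E) = +oo)%E.
Proof.
have [iid_omega omega01] := env_omega.
have [eps [/andP[eps_gt0 eps_lt] elliptic0]] := elliptic.
have delta01 : 0 < (1 - alpha) / 4 <= 1 by lra.
have valleys := ae_environment_valleys iid_omega omega01 eps_gt0 eps_lt
  elliptic0 mean0 var_gt0 delta01.
have ell := ae_elliptic iid_omega elliptic0.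
apply: filterS2 ell valleys => t ell_t valleys_t d' T' Q X walkX.
exact: (valleys_return_series_eqy walkX eps_gt0 ell_t alpha01 valleys_t).
Qed.
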